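(* Let $M$ be a closed $\lambda$-term. Then $M$ has a weak head normal form if and only if its translation $\mathcal T(M)$ converges, i.e. if and only if $\mathrm{supers}((\texttt{\_\_whnf},\texttt{\_\_parameter}))\ne\varnothing$ in the inheritance-calculus semantics of the document $\mathcal T(M)$.
   Context: **Documents.** A node is a scalar (a tag and a string), a sequence (a tag and a finite list of nodes) or a mapping (a tag and a finite list of pairs of nodes). The relevant tags are !!seq, !!map, !!str, !!null. A program (document) is a finite node $\mathrm{doc}$. Labels are strings; a path is a finite sequence of labels; $()$ is the root path; $p\triangleright\ell$ appends a label; $p\frown w$ concatenates a label sequence; for $p\ne()$, $\mathrm{init}(p)$ drops the last label and $\mathrm{last}(p)$ is the last label (both undefined at $()$). Set comprehensions silently omit terms in which a partial function is undefined, and are empty if their source is undefined. **Surface form.** A mixin body is a !!seq sequence of members; a member is either a reference (a !!seq sequence of scalars, written $[\ell_1,\dots,\ell_k]$) or a definition (a single-pair !!map mapping $\ell: m$ from a !!str scalar $\ell$ to a mixin body $m$). **Syntactic helpers.** $\mathrm{items}(\mathit{node})$ is the list of children if $\mathit{node}$ is a !!seq sequence (undefined otherwise). $\mathrm{kv}(\mathit{node})=(\ell,m)$ if $\mathit{node}$ is a !!map mapping with exactly one pair, whose key is a !!str scalar with content $\ell$ and whose value is $m$ (undefined otherwise). $\mathrm{at}(())=\mathrm{doc}$; $\mathrm{at}(p\triangleright\ell)$ is the unique $m$ with $(\ell,m)=\mathrm{kv}(\mathit{node})$ for some $\mathit{node}\in\mathrm{items}(\mathrm{at}(p))$. $\mathrm{has}(p,\ell)$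 holds iff some $\mathit{node}\in\mathrm{items}(\mathrm{at}(p))$ has $\mathrm{kv}(\mathit{node})=(\ell,\_)$. $\mathrm{lexical}(p,\ell)=0$ if $\mathrm{has}(p,\ell)$, else $1+\mathrm{lexical}(\mathrm{init}(p),\ell)$. For a reference $r=(s_1,\dots,s_k)$ of labels (the only kind used by $\mathcal T$), $\mathrm{indexed}(p,r)=(\mathrm{lexical}(\mathrm{init}(p),s_1),(s_1,\dots,s_k))$. $\mathrm{dom}(\mathrm{inherits})=\{p: p=()\text{ or }\mathrm{has}(\mathrm{init}(p),\mathrm{last}(p))\}$, and for $p$ in it $\mathrm{inherits}(p)=\{\mathrm{indexed}(p,\mathrm{items}(r)) : r\in\mathrm{items}(\mathrm{at}(p))\}\subseteq\mathbb N\times\mathrm{Label}^*$. **Semantics.** The five functions are the least solution (pointwise inclusion; least fixed point of the associated monotone operator) of: - $\mathrm{supers}(())=\{((),())\}$; $\mathrm{supers}(p\triangleright\ell)=\{(\mathrm{init}(b),o): b\in\mathrm{bases}^*(p\triangleright\ell),\ o\in\mathrm{overrides}(b)\}$, with $\mathrm{bases}^*$ the reflexive-transitive closure; - $\mathrm{overrides}(())=\{()\}$; $\mathrm{overrides}(p\triangleright\ell)=\{o : (\_,b)\in\mathrm{supers}(p),\ b\triangleright\ell\in\mathrm{dom}(\mathrm{inherits}),\ o\in\{p\triangleright\ell,\,b\triangleright\ell\}\}$; - $\mathrm{bases}(())=\varnothing$; $\mathrm{bases}(p\triangleright\ell)=\{t : o\in\mathrm{overrides}(p\triangleright\ell),\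 (n,w)\in\mathrm{inherits}(o),\ t\in\mathrm{resolve}(p,o,n,w)\}$; - $\mathrm{resolve}(s,d,n,w)=\{c\frown w : c\in\mathrm{this}(\{s\},\mathrm{init}(d),n)\}$; - $\mathrm{this}(S,d,0)=S$; for $n>0$, $\mathrm{this}(S,d,n)=\bigcup_{c\in S}\bigcup_{(t,d)\in\mathrm{supers}(c)}\mathrm{this}(\{t\},\mathrm{init}(d),n-1)$. **Translation.** $\lambda$-terms $M::=x\mid\lambda x.M\mid M_1\,M_2$ (variable names are labels, disjoint from the five labels \texttt{\_\_whnf}, \texttt{\_\_parameter}, \texttt{\_\_result}, \texttt{\_\_call}, \texttt{\_\_callee}) are mapped to mixin bodies: - $\mathcal T(x)$: the single member reference $[x]$; - $\mathcal T(\lambda x.M)$: the single definition of \texttt{\_\_whnf}, whose body has three definitions: $x$ with body the single reference $[\texttt{\_\_parameter}]$; \texttt{\_\_parameter} with empty body; \texttt{\_\_result} with body $\mathcal T(M)$; - $\mathcal T(M_1\,M_2)$: three definitions: \texttt{\_\_callee} with body $\mathcal T(M_1)$; \texttt{\_\_call} with body consisting of the reference $[\texttt{\_\_callee},\texttt{\_\_whnf}]$ and the definition of \texttt{\_\_parameter} with body $\mathcal T(M_2)$; \texttt{\_\_whnf} with body the single reference $[\texttt{\_\_call},\texttt{\_\_result},\texttt{\_\_whnf}]$. **Weak head normal form.** Weak-head reduction: $(\lambda x.e)\,v\,M_1\cdots M_k\to_h e[v/x]\,M_1\cdots M_k$. $M$ has a weak head normal form if it weak-head reduces in finitely many steps to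 a term with no weak-head redex (an abstraction, or a variable applied to arguments). *)

(* Defs.v *)
From Stdlib Require Export List String Relations.
Export ListNotations.

Definition tag := string.
Definition label := string.
Definition path := list label.

Definition tag_seq : tag := "!!seq"%string.
Definition tag_map : tag := "!!map"%string.
Definition tag_str : tag := "!!str"%string.

Inductive node : Type :=
| Scalar (t : tag) (content : string)
| Seq (t : tag) (children : list node)
| Mapping (t : tag) (pairs : list (node * node)).

(** Paths are lists of labels read from the root, so that appending a label
    [l] to [p] is [p ++ [l]].  Partial functions are either [option]-valued or
    functional relations. *)
Definition init (p : path) : option path :=
  match p with
  | [] => None
  | _ :: _ => Some (removelast p)
  end.

Definition items (nd : node) : option (list node) :=
  match nd with
  | Seq t ns => if String.eqb t tag_seq then Some ns else None
  | _ => None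
  end.

Definition kv (nd : node) : option (label * node) :=
  match nd with
  | Mapping t [(Scalar t' l, m)] =>
      if andb (String.eqb t tag_map) (String.eqb t' tag_str)
      then Some (l, m) else None
  | _ => None
  end.

(** [node_at doc p m]: the partial function "at" is defined at [p], with
    value [m]. *)
Inductive node_at (doc : node) : path -> node -> Prop :=
| node_at_root : node_at doc [] doc
| node_at_snoc p l nd ns m :
    node_at doc p nd ->
    items nd = Some ns ->
    unique (fun m' => exists x, In x ns /\ kv x = Some (l, m')) m ->
    node_at doc (p ++ [l]) m.

Definition has (doc : node) (p : path) (l : label) : Prop :=
  exists nd ns x m,
    node_at doc p nd /\ items nd = Some ns /\ In x ns /\ kv x = Some (l, m).

(** Undefined when no enclosing scope of [p] defines [l]. *)
Inductive lexical (doc : node) : path -> label -> nat -> Prop :=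
| lexical_here p l : has doc p l -> lexical doc p l 0
| lexical_up p q l n :
    ~ has doc p l -> init p = Some q -> lexical doc q l n ->
    lexical doc p l (S n).

(** The sequence of labels denoted by a list of nodes, if all of them are
    [!!str] scalars. *)
Fixpoint labels (ns : list node) : option (list label) :=
  match ns with
  | [] => Some []
  | Scalar t s :: ns' =>
      if String.eqb t tag_str then option_map (cons s) (labels ns') else None
  | _ :: _ => None
  end.

Definition indexed (doc : node) (p : path) (r : list node)
    (n : nat) (w : list label) : Prop :=
  exists q s w',
    init p = Some q /\ labels r = Some w /\ w = s :: w' /\ lexical doc q s n.

Definition dom_inherits (doc : node) (p : path) : Prop :=
  p = [] \/ exists q l, p = q ++ [l] /\ has doc q l.

Definition inherits (doc : node) (p : path) (n : nat) (w : list label) : Prop :=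
  dom_inherits doc p /\
  exists nd ns x r,
    node_at doc p nd /\ items nd = Some ns /\ In x ns /\
    items x = Some r /\ indexed doc p r n w.

(** The least solution of the five semantic equations.  A set-valued function
    is the relation between its arguments and the elements of its value, and
    each constructor is one inclusion "right-hand side in left-hand side";
    premises [init _ = Some _] drop the terms where [init] is undefined. *)
Inductive supers (doc : node) : path -> path * path -> Prop :=
| supers_root : supers doc [] ([], [])
| supers_snoc p l b b' o :
    clos_refl_trans path (bases doc) (p ++ [l]) b ->
    init b = Some b' ->
    overrides doc b o ->
    supers doc (p ++ [l]) (b', o)

with overrides (doc : node) : path -> path -> Prop :=
| overrides_root : overrides doc [] []
| overrides_snoc p l a b o :
    supers doc p (a, b) ->
    dom_inherits doc (b ++ [l]) ->
    o = p ++ [l] \/ o = b ++ [l] ->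
    overrides doc (p ++ [l]) o

with bases (doc : node) : path -> path -> Prop :=
| bases_snoc p l o n w t :
    overrides doc (p ++ [l]) o ->
    inherits doc o n w ->
    resolve doc p o n w t ->
    bases doc (p ++ [l]) t

with resolve (doc : node) :
    path -> path -> nat -> list label -> path -> Prop :=
| resolve_intro s d d' n w c :
    init d = Some d' ->
    this doc (eq s) d' n c ->
    resolve doc s d n w (c ++ w)

with this (doc : node) : (path -> Prop) -> path -> nat -> path -> Prop :=
| this_zero (S : path -> Prop) d c : S c -> this doc S d 0 c
| this_succ (S : path -> Prop) d d' n c t e :
    S c ->
    supers doc c (t, d) ->
    init d = Some d' ->
    this doc (eq t) d' n e ->
    this doc S d (Datatypes.S n) e.

Definition l_whnf : label := "__whnf"%string.
Definition l_parameter : label := "__parameter"%string.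
Definition l_result : label := "__result"%string.
Definition l_call : label := "__call"%string.
Definition l_callee : label := "__callee"%string.

Definition reserved : list label :=
  [l_whnf; l_parameter; l_result; l_call; l_callee].

Inductive term : Type :=
| Var (x : label)
| Lam (x : label) (M : term)
| App (M1 M2 : term).

(** All variable names of the term, free or bound, are unreserved labels. *)
Fixpoint unreserved (M : term) : Prop :=
  match M with
  | Var x => ~ In x reserved
  | Lam x M' => ~ In x reserved /\ unreserved M'
  | App M1 M2 => unreserved M1 /\ unreserved M2
  end.

Fixpoint fv (M : term) : list label :=
  match M with
  | Var x => [x]
  | Lam x M' => remove string_dec x (fv M')
  | App M1 M2 => fv M1 ++ fv M2
  end.

Definition closed (M : term) : Prop := fv M = [].

(** A string ["xx...x"] longer than every string of [xs]; it is never
    reserved. *)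
Definition fresh (xs : list label) : label :=
  String.concat "" (repeat "x"%string (S (list_max (map String.length xs)))).

Definition update (s : label -> term) (x : label) (N : term) : label -> term :=
  fun y => if string_dec y x then N else s y.

(** Capture-avoiding simultaneous substitution; a bound variable is renamed
    only when it would capture. *)
Fixpoint subst (s : label -> term) (M : term) : term :=
  match M with
  | Var x => s x
  | Lam x M' =>
      let avoid := flat_map (fun y => fv (s y)) (fv (Lam x M')) in
      let z := if in_dec string_dec x avoid then fresh avoid else x in
      Lam z (subst (update s x (Var z)) M')
  | App M1 M2 => App (subst s M1) (subst s M2)
  end.

Definition subst1 (x : label) (N M : term) : term := subst (update Var x N) M.

Inductive whred : term -> term -> Prop :=
| whred_beta x e v Ms :
    whred (fold_left App Ms (App (Lam x e) v)) (fold_left App Ms (subst1 x v e)).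

Definition is_whnf (M : term) : Prop := ~ exists N, whred M N.

Definition has_whnf (M : term) : Prop :=
  exists N, clos_refl_trans term whred M N /\ is_whnf N.

Definition reference (w : list label) : node :=
  Seq tag_seq (map (Scalar tag_str) w).

Definition definition (l : label) (m : node) : node :=
  Mapping tag_map [(Scalar tag_str l, m)].

Definition body (members : list node) : node := Seq tag_seq members.

Fixpoint translate (M : term) : node :=
  match M with
  | Var x => body [reference [x]]
  | Lam x M' =>
      body [definition l_whnf (body
        [ definition x (body [reference [l_parameter]]);
          definition l_parameter (body []);
          definition l_result (translate M') ])]
  | App M1 M2 =>
      body
        [ definition l_callee (translate M1);
          definition l_call (body
            [ reference [l_callee; l_whnf];
              definition l_parameter (translate M2) ]);
          definition l_whnf (body [reference [l_call; l_result; l_whnf]]) ]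
  end.

Definition converges (doc : node) : Prop :=
  exists s, supers doc [l_whnf; l_parameter] s.

(* Main.v *)
Require Import Defs.

(* The machine below evaluates closed terms by name over paths: a closure is a
   site of the document, i.e. the position of a subterm, together with the path
   of the scope in which it was created.  Environments are not stored; a
   variable is found by climbing the enclosing scopes, as "this" does, to the
   call that instantiates its binder.  The relevant part of "supers" is exactly
   the reachability of this machine (in one direction because the least solution
   is contained in any relation closed under the equations), and the machine is
   deterministic, so that the substitutions read back from its closures relate
   it to call-by-name evaluation, i.e. to weak head reduction. *)

(** * Substitution and weak head reduction *)

(** The translation turns a beta step into inheritance. Since [__call] inherits [__whnf] of
    [__callee], the call path carries both the body of the abstraction that the callee evaluates to
    and the argument, under [__parameter]. There the binder refers to [__parameter], hence to the
    argument, and [__result] is the abstraction body with the call as its scope. The test path works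
    for a similar reason: below [__whnf], [__parameter] is defined only by an abstraction, so it has
    supers exactly when the chain of [__whnf] references from the root reaches one. The obstacle is
    that the semantic relations hold of much that evaluation never reaches: pairs whose second
    component is a body without definitions, and the instance path that [overrides] adds beside the
    site. The invariants are therefore conditional. They speak of pairs whose second component
    defines some label, the only ones from which a further override or a step of a climb arises. *)

Inductive eval : term -> term -> Prop :=
| eval_lam x e : eval (Lam x e) (Lam x e)
| eval_app a b x e v :
    eval a (Lam x e) -> eval (subst1 x b e) v -> eval (App a b) v.

Lemma closed_app a b : closed (App a b) -> closed a /\ closed b.
Proof. apply app_eq_nil. Qed.

(* Weak head reduction of closed terms only substitutes closed terms; under
   this condition [subst] never renames a binder, so no alpha-equivalence
   reasoning is needed. *)
Definition plain (s : label -> term) (M : term) : Prop :=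
  forall y, In y (fv M) -> closed (s y) \/ s y = Var y.

Lemma update_eq s x N : update s x N x = N.
Proof. unfold update; destruct (string_dec x x); congruence. Qed.

Lemma update_neq s x y N : y <> x -> update s x N y = s y.
Proof. unfold update; destruct (string_dec y x); congruence. Qed.

Lemma in_fv_lam x y e : In y (fv e) -> y <> x -> In y (fv (Lam x e)).
Proof. intros; simpl; now apply in_in_remove. Qed.

Lemma plain_update s x N e :
  plain s (Lam x e) -> closed N \/ N = Var x -> plain (update s x N) e.
Proof.
  intros Hs HN y Hy.
  destruct (string_dec y x) as [->|n]; [rewrite update_eq | rewrite update_neq]; auto.
  now apply Hs, in_fv_lam.
Qed.

Lemma plain_app s a b : plain s (App a b) -> plain s a /\ plain s b.
Proof. intros H; split; intros y Hy; apply H; simpl; apply in_or_app; auto. Qed.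

(** Renaming would need [x] free in some [s y] with [y] free in [Lam x e]. A closed image has no
    free variable, and [s y = Var y] would force [y = x], which is not free under its own binder. *)
Lemma subst_lam s x e :
  plain s (Lam x e) -> subst s (Lam x e) = Lam x (subst (update s x (Var x)) e).
Proof.
  intros Hs; cbn [subst].
  destruct in_dec as [i|_]; trivial.
  apply in_flat_map in i; destruct i as (y & Hy & Hx).
  destruct (Hs y Hy) as [Hc|E].
  - rewrite Hc in Hx; destruct Hx.
  - rewrite E in Hx; destruct Hx as [<-|[]].
    simpl in Hy; now apply in_remove in Hy.
Qed.

Lemma subst_ext s s' M :
  plain s M -> (forall y, In y (fv M) -> s y = s' y) -> subst s M = subst s' M.
Proof.
  revert s s'; induction M as [x|x e IH|a IHa b IHb]; intros s s' Hs E.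
  - apply E; simpl; auto.
  - rewrite !subst_lam; trivial.
    + f_equal; apply IH; [apply plain_update; auto|].
      intros y Hy; destruct (string_dec y x) as [->|n].
      * now rewrite !update_eq.
      * rewrite !update_neq by trivial; now apply E, in_fv_lam.
    + intros y Hy; rewrite <- E by trivial; auto.
  - apply plain_app in Hs; destruct Hs.
    simpl; f_equal; [apply IHa|apply IHb]; trivial;
      intros y Hy; apply E; simpl; apply in_or_app; auto.
Qed.

Lemma subst_id s M : (forall y, In y (fv M) -> s y = Var y) -> subst s M = M.
Proof.
  revert s; induction M as [x|x e IH|a IHa b IHb]; intros s E.
  - apply E; simpl; auto.
  - rewrite subst_lam by (intros y Hy; auto).
    f_equal; apply IH; intros y Hy.
    destruct (string_dec y x) as [->|n]; [apply update_eq|].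
    rewrite update_neq by trivial; now apply E, in_fv_lam.
  - simpl; f_equal; [apply IHa|apply IHb]; intros y Hy; apply E; simpl;
      apply in_or_app; auto.
Qed.

Lemma subst_closed s M : closed M -> subst s M = M.
Proof. intros H; apply subst_id; rewrite H; intros y []. Qed.

Lemma in_fv_subst s M y :
  plain s M -> In y (fv (subst s M)) -> In y (fv M) /\ s y = Var y.
Proof.
  revert s; induction M as [x|x e IH|a IHa b IHb]; intros s Hs Hy.
  - simpl in Hy |- *; destruct (Hs x) as [Hc|E]; [simpl; auto| |].
    + rewrite Hc in Hy; destruct Hy.
    + rewrite E in Hy; destruct Hy as [<-|[]]; auto.
  - rewrite subst_lam in Hy by trivial; simpl in Hy.
    apply in_remove in Hy; destruct Hy as [Hy n].
    destruct (IH _ (plain_update _ _ _ _ Hs (or_intror eq_refl)) Hy) as [Hi E].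
    rewrite update_neq in E by trivial.
    split; trivial; now apply in_fv_lam.
  - apply plain_app in Hs; destruct Hs; simpl in Hy |- *.
    apply in_app_or in Hy; rewrite in_app_iff; firstorder.
Qed.

Lemma closed_subst s M :
  (forall y, In y (fv M) -> closed (s y)) -> closed (subst s M).
Proof.
  intros H; unfold closed.
  destruct (fv (subst s M)) as [|y ys] eqn:E; trivial.
  destruct (in_fv_subst s M y) as [Hi Hv].
  - intros z Hz; auto.
  - rewrite E; simpl; auto.
  - apply H in Hi; rewrite Hv in Hi; discriminate.
Qed.

Lemma fv_subst_in s M y :
  plain s M -> In y (fv M) -> s y = Var y -> In y (fv (subst s M)).
Proof.
  revert s; induction M as [x|x e IH|a IHa b IHb]; intros s Hs Hi E.
  - destruct Hi as [->|[]]; simpl; rewrite E; simpl; auto.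
  - rewrite subst_lam by trivial.
    simpl in Hi; apply in_remove in Hi; destruct Hi as [Hi n].
    apply in_fv_lam; trivial.
    apply IH; trivial; [apply plain_update; auto|].
    now rewrite update_neq.
  - apply plain_app in Hs; destruct Hs.
    simpl in Hi |- *; rewrite in_app_iff in *; firstorder.
Qed.

Lemma subst_subst s s' M :
  plain s M -> plain s' (subst s M) ->
  subst s' (subst s M) = subst (fun y => subst s' (s y)) M.
Proof.
  revert s s'; induction M as [x|x e IH|a IHa b IHb]; intros s s' Hs Hs'.
  - reflexivity.
  (* The composite is again plain: closed images are fixed by [s'], and an unchanged variable stays
     free in the substituted term, where [s'] is plain. *)
  - assert (Hc : plain (fun y => subst s' (s y)) (Lam x e)).
    { intros y Hy; destruct (Hs y Hy) as [Hc|E].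
      - left; now rewrite subst_closed.
      - rewrite E; simpl; apply Hs', fv_subst_in; trivial. }
    rewrite (subst_lam (fun y => subst s' (s y))) by trivial.
    rewrite (subst_lam s) in Hs' |- * by trivial.
    rewrite subst_lam by trivial.
    f_equal.
    rewrite IH by (apply plain_update; auto).
    assert (Hpl : plain (update (fun y => subst s' (s y)) x (Var x)) e)
      by (apply plain_update; auto).
    symmetry; apply subst_ext; trivial.
    intros y Hy; destruct (string_dec y x) as [->|n].
    + rewrite !update_eq; simpl; now rewrite update_eq.
    + rewrite !update_neq by trivial.
      destruct (Hs y) as [Hcl|E]; [now apply in_fv_lam| |].
      * now rewrite !subst_closed.
      * rewrite E; simpl; now rewrite update_neq.
  - apply plain_app in Hs; destruct Hs; simpl in Hs' |- *.
    apply plain_app in Hs'; destruct Hs'.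
    f_equal; auto.
Qed.

(** Contracting a redex whose abstraction was already substituted amounts to adding one binding to
    the environment, as the machine does at a call. *)
Lemma subst1_subst s x v e :
  (forall y, In y (fv (Lam x e)) -> closed (s y)) -> closed v ->
  subst1 x v (subst (update s x (Var x)) e) = subst (update s x v) e.
Proof.
  intros Hs Hv; unfold subst1.
  assert (Hp : plain s (Lam x e)) by (intros y Hy; auto).
  rewrite subst_subst.
  - symmetry; apply subst_ext; [apply plain_update; auto|].
    intros y Hy; destruct (string_dec y x) as [->|n].
    + rewrite !update_eq; simpl; now rewrite update_eq.
    + rewrite !update_neq by trivial.
      rewrite subst_closed; trivial; now apply Hs, in_fv_lam.
  - apply plain_update; auto.
  - intros y Hy; destruct (string_dec y x) as [->|n].
    + left; now rewrite update_eq.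
    + right; now rewrite update_neq.
Qed.

Lemma closed_subst1 x v e : closed (Lam x e) -> closed v -> closed (subst1 x v e).
Proof.
  intros He Hv; apply closed_subst; intros y Hy.
  destruct (string_dec y x) as [->|n]; [now rewrite update_eq|].
  apply in_fv_lam with (x := x) in Hy; trivial.
  rewrite He in Hy; destruct Hy.
Qed.

(** * Weak head steps and evaluation to an abstraction *)

Lemma whred_app a a' b : whred a a' -> whred (App a b) (App a' b).
Proof.
  destruct 1 as [x e v Ms].
  pose proof (whred_beta x e v (Ms ++ [b])) as H.
  now rewrite !fold_left_app in H.
Qed.

(** Splitting the spine [Ms] at its last argument replaces the spine form by a congruence in
    function position, which suits induction on terms. *)
Lemma whred_cases N N' :
  whred N N' ->
  (exists x e v, N = App (Lam x e) v /\ N' = subst1 x v e) \/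
  (exists a a' b, N = App a b /\ N' = App a' b /\ whred a a').
Proof.
  destruct 1 as [x e v Ms].
  destruct Ms as [|m Ms' _] using rev_ind.
  - left; exists x, e, v; auto.
  - right; rewrite !fold_left_app; simpl.
    do 3 eexists; repeat split.
Qed.

Lemma closed_whred N N' : whred N N' -> closed N -> closed N'.
Proof.
  revert N'; induction N as [x|x e IH|a IHa b IHb]; intros N' H Hc;
    destruct (whred_cases _ _ H) as [(y & f & v & E & ->)|(f & f' & g & E & -> & Hf)];
    inversion E; subst; apply closed_app in Hc; destruct Hc as [Ha Hb].
  - now apply closed_subst1.
  - unfold closed; simpl; rewrite (IHa _ Hf Ha); exact Hb.
Qed.

Lemma eval_whred N N' v : whred N N' -> eval N' v -> eval N v.
Proof.
  revert N' v; induction N as [x|x e IH|a IHa b IHb]; intros N' v H Hv;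
    destruct (whred_cases _ _ H) as [(y & f & w & E & ->)|(f & f' & g & E & -> & Hf)];
    inversion E; subst.
  - econstructor; [constructor|exact Hv].
  - inversion Hv; subst; econstructor; eauto.
Qed.

Lemma eval_is_lam N v : eval N v -> exists x e, v = Lam x e.
Proof. induction 1; eauto. Qed.

Lemma eval_reduces N v : eval N v -> clos_refl_trans term whred N v.
Proof.
  induction 1 as [|a b x e v _ IHa _ IHv]; [apply rt_refl|].
  apply rt_trans with (App (Lam x e) b).
  - clear - IHa; induction IHa as [a a' H| |a a' a'' _ IH1 _ IH2].
    + now apply rt_step, whred_app.
    + apply rt_refl.
    + now apply rt_trans with (App a' b).
  - apply rt_trans with (subst1 x b e); trivial.
    apply rt_step; exact (whred_beta x e b []).
Qed.

Lemma closed_progress N : closed N -> (exists x e, N = Lam x e) \/ exists N', whred N N'.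
Proof.
  induction N as [x|x e IH|a IHa b IHb]; intros Hc; [discriminate|eauto|right].
  apply closed_app in Hc; destruct Hc as [Ha _].
  destruct (IHa Ha) as [(x & e & ->)|[a' Ha']].
  - exists (subst1 x b e); exact (whred_beta x e b []).
  - exists (App a' b); now apply whred_app.
Qed.

(** A closed term is an abstraction or takes a step, so its weak head normal form is an abstraction;
    [eval] is then carried back along the reduction. *)
Lemma has_whnf_eval M : closed M -> has_whnf M <-> exists v, eval M v.
Proof.
  intros Hc; split.
  - intros (N & HN & Hw); apply clos_rt_rt1n in HN.
    induction HN as [M|M M' N H HN IH].
    + destruct (closed_progress M Hc) as [(x & e & ->)|[N H]].
      * eexists; constructor.
      * destruct Hw; eauto.
    + destruct IH as [v Hv]; trivial; [now apply closed_whred with M|].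
      exists v; now apply eval_whred with M'.
  - intros [v Hv]; exists v; split; [now apply eval_reduces|].
    destruct (eval_is_lam _ _ Hv) as (x & e & ->).
    intros [N HN]; destruct (whred_cases _ _ HN)
      as [(? & ? & ? & E & _)|(? & ? & ? & E & _)]; discriminate.
Qed.

(** * Positions of the document *)

(* Paths are reversed from here on, so that the last label is the head of the
   list and inversion can see it. *)
Inductive site (M0 : term) : path -> term -> Prop :=
| site_root : unreserved M0 -> site M0 [] M0
| site_callee d a b : site M0 d (App a b) -> site M0 (l_callee :: d) a
| site_argument d a b :
    site M0 d (App a b) -> site M0 (l_parameter :: l_call :: d) b
| site_result d x e :
    site M0 d (Lam x e) -> site M0 (l_result :: l_whnf :: d) e.

Inductive position (M0 : term) : path -> node -> Prop :=
| position_site d N : site M0 d N -> position M0 d (translate N)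
| position_call d a b :
    site M0 d (App a b) ->
    position M0 (l_call :: d)
      (body [reference [l_callee; l_whnf]; definition l_parameter (translate b)])
| position_app_whnf d a b :
    site M0 d (App a b) ->
    position M0 (l_whnf :: d) (body [reference [l_call; l_result; l_whnf]])
| position_lam_whnf d x e :
    site M0 d (Lam x e) ->
    position M0 (l_whnf :: d)
      (body [definition x (body [reference [l_parameter]]);
             definition l_parameter (body []);
             definition l_result (translate e)])
| position_binder d x e :
    site M0 d (Lam x e) ->
    position M0 (x :: l_whnf :: d) (body [reference [l_parameter]])
| position_parameter d x e :
    site M0 d (Lam x e) -> position M0 (l_parameter :: l_whnf :: d) (body []).

Lemma site_unreserved M0 d N : site M0 d N -> unreserved N.
Proof. induction 1; simpl in *; tauto. Qed.

Lemma binder_unreserved M0 d x e : site M0 d (Lam x e) -> ~ In x reserved.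
Proof. intros H; apply site_unreserved in H; apply H. Qed.

Ltac binder_clash :=
  exfalso;
  match goal with
  | H : site _ _ (Lam ?x _) |- _ =>
    solve [apply (binder_unreserved _ _ _ _ H); subst; simpl; tauto]
  | H : ~ In _ reserved |- _ => solve [apply H; subst; simpl; tauto]
  end.

Lemma site_functional M0 d N N' : site M0 d N -> site M0 d N' -> N = N'.
Proof.
  intros H; revert N';
    induction H as [H|d a b H IH|d a b H IH|d x e H IH]; intros N' H';
    inversion H' as [|? ? ? H1|? ? ? H1|? ? ? H1]; subst; trivial;
    apply IH in H1; congruence.
Qed.

Lemma no_site_call M0 d N : ~ site M0 (l_call :: d) N.
Proof. inversion 1. Qed.

Lemma no_site_whnf M0 d N : ~ site M0 (l_whnf :: d) N.
Proof. inversion 1. Qed.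

Lemma init_snoc p l : init (p ++ [l]) = Some p.
Proof.
  rewrite <- (removelast_last p l) at 2.
  unfold init; destruct (p ++ [l]) eqn:E; trivial.
  now apply app_eq_nil in E.
Qed.

Lemma init_some p q : init p = Some q -> exists l, rev p = l :: rev q.
Proof.
  destruct p as [|l p]; [discriminate|].
  destruct (exists_last (l := l :: p)) as (p' & l' & E); [discriminate|].
  rewrite E, init_snoc; intros [= <-]; exists l'; apply rev_unit.
Qed.

Lemma node_at_position M0 p m :
  unreserved M0 -> node_at (translate M0) p m -> position M0 (rev p) m.
Proof.
  intros Hu; induction 1 as [|p l nd ns m _ IH Hi [[y [Hy Hk]] _]].
  - now apply (position_site _ [] M0), site_root.
  - rewrite rev_unit.
    inversion IH as [d N Hs|d a b Hs|d a b Hs|d x e Hs|d x e Hs|d x e Hs]; subst;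
      try destruct N; simpl in Hi; injection Hi as <-; simpl in Hy;
      repeat (destruct Hy as [<-|Hy]); try contradiction;
      simpl in Hk; try discriminate; injection Hk as <- <-.
    + eapply position_lam_whnf; eassumption.
    + eapply position_site, site_callee; eassumption.
    + eapply position_call; eassumption.
    + eapply position_app_whnf; eassumption.
    + eapply position_site, site_argument; eassumption.
    + eapply position_binder; eassumption.
    + eapply position_parameter; eassumption.
    + eapply position_site, site_result; eassumption.
Qed.

(** The last premise is the uniqueness built into [node_at]. In the body of an abstraction it holds
    because the binder differs from [__parameter] and [__result]. *)
Lemma node_at_child doc d l ns m :
  node_at doc (rev d) (body ns) ->
  In (definition l m) ns ->
  (forall x m', In x ns -> kv x = Some (l, m') -> m = m') ->
  node_at doc (rev (l :: d)) m.
Proof.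
  intros Hd Hi Hu; cbn [rev].
  eapply node_at_snoc; [exact Hd|reflexivity|].
  split; [now exists (definition l m)|].
  intros m' (x & Hx & Hk); eauto.
Qed.

Ltac member := repeat first [left; reflexivity | right].

Ltac solve_child :=
  match goal with
  | |- In _ _ => member
  | |- forall x m, _ -> _ -> _ =>
    let y := fresh in let m := fresh in let H := fresh in let E := fresh in
    intros y m H E; simpl in H;
    repeat (destruct H as [<-|H]; [simpl in E; try discriminate E|]);
    try contradiction; injection E; intros; subst; trivial; try binder_clash
  end.

Lemma site_node_at M0 d N :
  site M0 d N -> node_at (translate M0) (rev d) (translate N).
Proof.
  induction 1 as [H|d a b H IH|d a b H IH|d x e H IH].
  - constructor.
  - eapply node_at_child; [exact IH|..]; solve_child.
  - eapply node_at_child; [eapply node_at_child; [exact IH|..]|..]; solve_child.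
  - eapply node_at_child; [eapply node_at_child; [exact IH|..]|..]; solve_child.
Qed.

Lemma position_node_at M0 d m :
  position M0 d m -> node_at (translate M0) (rev d) m.
Proof.
  destruct 1 as [d N H|d a b H|d a b H|d x e H|d x e H|d x e H];
    pose proof (site_node_at _ _ _ H) as H1; trivial.
  - eapply node_at_child; [exact H1|..]; solve_child.
  - eapply node_at_child; [exact H1|..]; solve_child.
  - eapply node_at_child; [exact H1|..]; solve_child.
  - eapply node_at_child; [eapply node_at_child; [exact H1|..]|..]; solve_child.
  - eapply node_at_child; [eapply node_at_child; [exact H1|..]|..]; solve_child.
Qed.

(** Variable sites, binder bodies, the [__whnf] of an application and the empty [__parameter]
    contain no definitions, which leaves four kinds of position. *)
Lemma has_inv M0 d l :
  unreserved M0 -> has (translate M0) (rev d) l ->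
  (exists a b, site M0 d (App a b) /\ (l = l_callee \/ l = l_call \/ l = l_whnf)) \/
  (exists x e, site M0 d (Lam x e) /\ l = l_whnf) \/
  (exists d' a b, d = l_call :: d' /\ site M0 d' (App a b) /\ l = l_parameter) \/
  (exists d' x e, d = l_whnf :: d' /\ site M0 d' (Lam x e) /\
    (l = x \/ l = l_parameter \/ l = l_result)).
Proof.
  intros Hu (nd & ns & y & m & Hn & Hi & Hy & Hk).
  apply node_at_position in Hn; trivial; rewrite rev_involutive in Hn.
  inversion Hn as [d' N Hs|d' a b Hs|d' a b Hs|d' x e Hs|d' x e Hs|d' x e Hs]; subst;
    try destruct N; simpl in Hi; injection Hi as <-; simpl in Hy;
    repeat (destruct Hy as [<-|Hy]); try contradiction;
    simpl in Hk; try discriminate; injection Hk as <- <-; eauto 10.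
  all: right; right; right; eauto 10.
Qed.

Lemma position_has M0 d ns l m :
  position M0 d (body ns) -> In (definition l m) ns ->
  has (translate M0) (rev d) l.
Proof.
  intros Hp Hi; apply position_node_at in Hp.
  exists (body ns), ns, (definition l m), m; auto.
Qed.

Ltac solve_has P := eapply position_has; [exact P|member].

Lemma has_callee M0 d a b :
  site M0 d (App a b) -> has (translate M0) (rev d) l_callee.
Proof. intros H; solve_has (position_site _ _ _ H). Qed.

Lemma has_call M0 d a b :
  site M0 d (App a b) -> has (translate M0) (rev d) l_call.
Proof. intros H; solve_has (position_site _ _ _ H). Qed.

Lemma has_whnf_label M0 d N :
  site M0 d N -> (forall x, N <> Var x) -> has (translate M0) (rev d) l_whnf.
Proof.
  intros H n; destruct N as [x|x e|a b]; [now destruct (n x)|..];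
    solve_has (position_site _ _ _ H).
Qed.

Lemma has_argument M0 d a b :
  site M0 d (App a b) -> has (translate M0) (rev (l_call :: d)) l_parameter.
Proof. intros H; solve_has (position_call _ _ _ _ H). Qed.

Lemma has_binder M0 d x e :
  site M0 d (Lam x e) -> has (translate M0) (rev (l_whnf :: d)) x.
Proof. intros H; solve_has (position_lam_whnf _ _ _ _ H). Qed.

Lemma has_parameter M0 d x e :
  site M0 d (Lam x e) -> has (translate M0) (rev (l_whnf :: d)) l_parameter.
Proof. intros H; solve_has (position_lam_whnf _ _ _ _ H). Qed.

Lemma has_result M0 d x e :
  site M0 d (Lam x e) -> has (translate M0) (rev (l_whnf :: d)) l_result.
Proof. intros H; solve_has (position_lam_whnf _ _ _ _ H). Qed.

Lemma dom_inherits_snoc doc p l : dom_inherits doc (p ++ [l]) <-> has doc p l.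
Proof.
  split.
  - intros [E|(q & l' & E & H)].
    + now apply app_eq_nil in E.
    + apply app_inj_tail in E; destruct E; now subst.
  - intros H; right; eauto.
Qed.

Lemma node_at_dom doc p m : node_at doc p m -> dom_inherits doc p.
Proof.
  destruct 1 as [|p l nd ns m Hn Hi [(x & Hx & Hk) _]]; [now left|].
  apply dom_inherits_snoc; exists nd, ns, x, m; auto.
Qed.

Lemma has_dom doc p l : has doc p l -> dom_inherits doc p.
Proof. intros (nd & ns & x & m & Hn & _); now apply node_at_dom in Hn. Qed.

Lemma lexical_functional doc p x n n' :
  lexical doc p x n -> lexical doc p x n' -> n = n'.
Proof.
  intros H; revert n'; induction H as [p x H|p q x n H Hi _ IH]; intros n' H';
    inversion H' as [|? q' ? ? ? Hi' H1]; subst; try contradiction; trivial.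
  f_equal; apply IH; congruence.
Qed.

(** Every reference inserted by the translation starts with a label of the immediately enclosing
    body, hence index 0; only references at variable sites can climb. *)
Lemma inherits_inv M0 o n w :
  unreserved M0 -> inherits (translate M0) (rev o) n w ->
  (exists l d x, o = l :: d /\ site M0 o (Var x) /\
    lexical (translate M0) (rev d) x n /\ w = [x]) \/
  (exists d a b, o = l_call :: d /\ site M0 d (App a b) /\ n = 0 /\
    w = [l_callee; l_whnf]) \/
  (exists d a b, o = l_whnf :: d /\ site M0 d (App a b) /\ n = 0 /\
    w = [l_call; l_result; l_whnf]) \/
  (exists d x e, o = x :: l_whnf :: d /\ site M0 d (Lam x e) /\ n = 0 /\
    w = [l_parameter]).
Proof.
  intros Hu (_ & nd & ns & y & r & Hn & Hi & Hy & Hr & q & s & w' & Hq & Hl & -> & Hx).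
  apply node_at_position in Hn; trivial; rewrite rev_involutive in Hn.
  apply init_some in Hq; destruct Hq as [l Eq]; rewrite rev_involutive in Eq.
  rewrite <- (rev_involutive q) in Hx; revert Eq Hx; generalize (rev q).
  intros d -> Hx.
  inversion Hn as [d' N Hs|d' a b Hs|d' a b Hs|d' x e Hs|d' x e Hs|d' x e Hs]; subst;
    try destruct N; simpl in Hi; injection Hi as <-; simpl in Hy;
    repeat (destruct Hy as [<-|Hy]); try contradiction;
    simpl in Hr; try discriminate; injection Hr as <-;
    simpl in Hl; injection Hl as <- <-.
  - left; eauto 10.
  - right; left; do 3 eexists; repeat split; eauto.
    apply (lexical_functional _ _ _ _ _ Hx), lexical_here.
    eapply has_callee; eassumption.
  - right; right; left; do 3 eexists; repeat split; eauto.
    apply (lexical_functional _ _ _ _ _ Hx), lexical_here.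
    eapply has_call; eassumption.
  - right; right; right; do 3 eexists; repeat split; eauto.
    apply (lexical_functional _ _ _ _ _ Hx), lexical_here.
    eapply has_parameter; eassumption.
Qed.

Lemma labels_scalars w : labels (map (Scalar tag_str) w) = Some w.
Proof. induction w as [|x w IH]; simpl; [|rewrite IH]; trivial. Qed.

Lemma position_inherits M0 l d ns x w n :
  position M0 (l :: d) (body ns) -> In (reference (x :: w)) ns ->
  lexical (translate M0) (rev d) x n ->
  inherits (translate M0) (rev (l :: d)) n (x :: w).
Proof.
  intros Hp Hi Hx; apply position_node_at in Hp.
  split; [now apply node_at_dom in Hp|].
  exists (body ns), ns, (reference (x :: w)), (map (Scalar tag_str) (x :: w)).
  repeat split; trivial.
  exists (rev d), x, w; repeat split; trivial.
  - apply init_snoc.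
  - apply labels_scalars.
Qed.

(** * The evaluation machine *)

(* [instance c t d]: the path [c] itself overrides the site [d], and [t] is the
   scope it was created in.
   [resolves c t d]: following variable references from [c] ends in the closure
   of the site [d] in the scope [t].
   [evaluates c t d]: the chain of bases of [__whnf] at [c] ends in the
   abstraction at the site [d], in the term path [t].
   [encloses c t d] is the relevant part of "(t, d) in supers(c)", and
   [climbs] is "this".  At the root the scope [t] is a junk value. *)
Inductive resolves (M0 : term) : path -> path -> path -> Prop :=
| resolves_instance c t d N :
    instance M0 c t d -> site M0 d N -> (forall x, N <> Var x) ->
    resolves M0 c t d
| resolves_var c t l d x n e t' d' :
    instance M0 c t (l :: d) -> site M0 (l :: d) (Var x) ->
    lexical (translate M0) (rev d) x n -> climbs M0 t d n e ->
    resolves M0 (x :: e) t' d' -> resolves M0 c t' d'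
| resolves_binder c s d x f t' d' :
    evaluates M0 (l_callee :: c) s d -> site M0 d (Lam x f) ->
    resolves M0 (l_parameter :: l_call :: c) t' d' ->
    resolves M0 (x :: l_call :: c) t' d'

with instance (M0 : term) : path -> path -> path -> Prop :=
| instance_root : instance M0 [] [] []
| instance_callee c t d a b :
    resolves M0 c t d -> site M0 d (App a b) ->
    instance M0 (l_callee :: c) c (l_callee :: d)
| instance_argument c t d a b :
    resolves M0 c t d -> site M0 d (App a b) ->
    instance M0 (l_parameter :: l_call :: c) (l_call :: c)
      (l_parameter :: l_call :: d)
| instance_result c s d x f :
    evaluates M0 (l_callee :: c) s d -> site M0 d (Lam x f) ->
    instance M0 (l_result :: l_call :: c) (l_call :: c) (l_result :: l_whnf :: d)

with evaluates (M0 : term) : path -> path -> path -> Prop :=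
| evaluates_lam c t d x f :
    resolves M0 c t d -> site M0 d (Lam x f) -> evaluates M0 c c d
| evaluates_app c t d a b s' d' s f :
    resolves M0 c t d -> site M0 d (App a b) ->
    evaluates M0 (l_callee :: c) s' d' ->
    evaluates M0 (l_result :: l_call :: c) s f -> evaluates M0 c s f

with encloses (M0 : term) : path -> path -> path -> Prop :=
| encloses_term c t d : resolves M0 c t d -> encloses M0 c t d
| encloses_call c t d a b :
    resolves M0 c t d -> site M0 d (App a b) ->
    encloses M0 (l_call :: c) c (l_call :: d)
| encloses_whnf c s d :
    evaluates M0 (l_callee :: c) s d ->
    encloses M0 (l_call :: c) s (l_whnf :: d)

with climbs (M0 : term) : path -> path -> nat -> path -> Prop :=
| climbs_zero t d : climbs M0 t d 0 t
| climbs_succ t t' l d n e :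
    encloses M0 t t' (l :: d) -> climbs M0 t' d n e ->
    climbs M0 t (l :: d) (S n) e.

Scheme resolves_mut := Minimality for resolves Sort Prop
with instance_mut := Minimality for instance Sort Prop
with evaluates_mut := Minimality for evaluates Sort Prop
with encloses_mut := Minimality for encloses Sort Prop
with climbs_mut := Minimality for climbs Sort Prop.

Combined Scheme machine_ind from
  resolves_mut, instance_mut, evaluates_mut, encloses_mut, climbs_mut.

(* The machine only visits these paths and their extensions by [__call] and
   [__whnf]; in particular not the uninstantiated body of an abstraction, about
   which nothing is claimed. *)
Inductive term_path : path -> Prop :=
| term_path_root : term_path []
| term_path_callee c : term_path c -> term_path (l_callee :: c)
| term_path_call l c :
    l = l_parameter \/ l = l_result \/ ~ In l reserved ->
    term_path c -> term_path (l :: l_call :: c).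

Lemma no_term_path_call c : ~ term_path (l_call :: c).
Proof.
  inversion 1 as [| |l c' Hl _]; subst; destruct Hl as [|[|n]]; try discriminate.
  apply n; simpl; tauto.
Qed.

Lemma term_path_callee_inv c : term_path (l_callee :: c) -> term_path c.
Proof.
  inversion 1 as [| |l c' Hl _]; subst; trivial.
  destruct Hl as [|[|n]]; try discriminate.
  destruct n; simpl; tauto.
Qed.

Lemma machine_term_path M0 :
  (forall c t d, resolves M0 c t d -> term_path c) /\
  (forall c t d, instance M0 c t d -> term_path c) /\
  (forall c t d, evaluates M0 c t d -> term_path c) /\
  (forall c t d, encloses M0 c t d ->
    term_path c \/ exists c', c = l_call :: c' /\ term_path c') /\
  (forall t d n e, climbs M0 t d n e -> True).
Proof.
  apply machine_ind; intros; trivial; eauto using term_path, term_path_callee_inv.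
  apply term_path_call; [|now apply term_path_callee_inv].
  right; right; eapply binder_unreserved; eassumption.
Qed.

Lemma resolves_term_path M0 c t d : resolves M0 c t d -> term_path c.
Proof. apply machine_term_path. Qed.

Lemma encloses_scope M0 c t d :
  encloses M0 c t d -> term_path c \/ exists c', c = l_call :: c' /\ term_path c'.
Proof. apply machine_term_path. Qed.

Lemma resolves_site M0 c t d :
  resolves M0 c t d -> exists N, site M0 d N /\ forall x, N <> Var x.
Proof. induction 1; eauto. Qed.

Lemma instance_site M0 c t d : unreserved M0 -> instance M0 c t d -> exists N, site M0 d N.
Proof.
  intros Hu; destruct 1; eexists; econstructor; eassumption.
Qed.

Lemma evaluates_resolves M0 c s d :
  evaluates M0 c s d ->
  (exists t, resolves M0 s t d) /\ (exists x f, site M0 d (Lam x f)).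
Proof. induction 1; eauto. Qed.

Lemma evaluates_origin M0 c s d :
  evaluates M0 c s d -> exists t f, resolves M0 c t f.
Proof. destruct 1; eauto. Qed.

Lemma encloses_term_path M0 c t d :
  term_path c -> encloses M0 c t d -> resolves M0 c t d.
Proof.
  intros Hc H; destruct H; trivial; now apply no_term_path_call in Hc.
Qed.

(** A [__result] below a call is instantiated only once the callee has become an abstraction. This
    recovers the callee premise of [evaluates_app], which a chain of [__whnf] bases does not
    record. *)
Lemma evaluates_callee M0 c s d :
  evaluates M0 (l_result :: l_call :: c) s d ->
  exists s' d', evaluates M0 (l_callee :: c) s' d'.
Proof.
  intros H; apply evaluates_origin in H; destruct H as (t & f & H).
  inversion H as [? ? ? N Hi|? ? ? ? ? ? ? ? ? Hi|? ? ? ? ? ? ? He]; subst;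
    try inversion Hi; subst; eauto.
Qed.

Lemma instance_parent M0 c t l d :
  instance M0 c t (l :: d) -> exists u, encloses M0 t u d.
Proof.
  inversion 1; subst; eexists;
    [eapply encloses_term|eapply encloses_call|eapply encloses_whnf]; eassumption.
Qed.

(** Following references changes the path but keeps the scope of the final instance, so a climb can
    always go on until it reaches the root site. *)
Lemma encloses_parent M0 c t l d :
  encloses M0 c t (l :: d) -> exists u, encloses M0 t u d.
Proof.
  inversion 1 as [? ? ? Hr|? ? ? ? ? Hr|? ? ? He]; subst.
  - clear H; remember (l :: d) as d0 eqn:E; revert E.
    induction Hr as [c t d0 N Hi|c t l' d' x n e t' d0 _ _ _ _ _ IH|c s d' x f t' d0 _ _ _ IH];
      intros ->; auto.
    now apply instance_parent in Hi.
  - eexists; eapply encloses_term; eassumption.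
  - apply evaluates_resolves in He; destruct He as [[u He] _].
    exists u; now apply encloses_term.
Qed.

Lemma encloses_has M0 c t d :
  encloses M0 c t d -> exists l, has (translate M0) (rev d) l.
Proof.
  destruct 1 as [c t d H|c t d a b _ H|c s d H].
  - apply resolves_site in H; destruct H as (N & H & n).
    eexists; eapply has_whnf_label; eassumption.
  - eexists; eapply has_argument; eassumption.
  - apply evaluates_resolves in H; destruct H as (_ & x & f & H).
    eexists; eapply has_parameter; eassumption.
Qed.

(** An unreserved label is defined only in the [__whnf] body of its abstraction, and such a site is
    enclosed only through a call whose callee evaluates to that abstraction. Hence the climb ends at
    the call that instantiates [x]. *)
Lemma climbs_binder M0 t u d x n e :
  unreserved M0 -> ~ In x reserved ->
  encloses M0 t u d -> lexical (translate M0) (rev d) x n -> climbs M0 t d n e ->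
  exists c s d' f, e = l_call :: c /\ evaluates M0 (l_callee :: c) s d' /\
    site M0 d' (Lam x f).
Proof.
  intros Hu Hx He Hl Hc; revert u He Hl.
  induction Hc as [t d|t t' l d n e H _ IH]; intros u He Hl.
  - inversion Hl as [? ? Hh|]; subst.
    apply has_inv in Hh; trivial.
    destruct Hh as [(a & b & _ & [E|[E|E]])|[(y & f & _ & E)|[(d' & a & b & _ & _ & E)|
      (d' & y & f & -> & Hs & [<-|[E|E]])]]]; try (subst; binder_clash).
    inversion He as [? ? ? Hr|?|? ? ? Hv]; subst.
    + apply resolves_site in Hr; destruct Hr as (N & Hr & _).
      now apply no_site_whnf in Hr.
    + eauto 10.
  - destruct (encloses_parent _ _ _ _ _ H) as [u' Hu'].
    inversion Hl as [|? q ? ? _ Hi Hl']; subst.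
    apply init_some in Hi; destruct Hi as [l' Hi].
    rewrite rev_involutive in Hi; injection Hi as _ Ed.
    rewrite <- (rev_involutive q), <- Ed in Hl'; eauto.
Qed.

(** The rules of [resolves] exclude one another by the shape of the site or by reserved against
    unreserved labels. [encloses] is functional only for a fixed site, since a call encloses both
    its own site and the body of the abstraction it applies; [climbs] always fixes the site. *)
Lemma machine_functional M0 :
  (forall c t d, resolves M0 c t d ->
    forall t' d', resolves M0 c t' d' -> t = t' /\ d = d') /\
  (forall c t d, instance M0 c t d ->
    forall t' d', instance M0 c t' d' -> t = t' /\ d = d') /\
  (forall c t d, evaluates M0 c t d ->
    forall t' d', evaluates M0 c t' d' -> t = t' /\ d = d') /\
  (forall c t d, encloses M0 c t d -> forall t', encloses M0 c t' d -> t = t') /\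
  (forall t d n e, climbs M0 t d n e -> forall e', climbs M0 t d n e' -> e = e').
Proof.
  apply machine_ind.
  - intros c t d N Hi IHi Hs n t' d' H'.
    inversion H' as [? ? ? N' Hi'|? ? l ? x ? ? ? ? Hi' Hs'|c' s d0 x f ? ? He Hs']; subst; auto.
    + destruct (IHi _ _ Hi') as [-> ->].
      destruct (n x); eapply site_functional; eassumption.
    + inversion Hi; subst; binder_clash.
  - intros c t l d x n e t' d' Hi IHi Hs Hl _ IHc _ IHr t2 d2 H'.
    inversion H' as [? ? ? N' Hi' Hs' n'
      |? ? l' ? x' n' e' ? ? Hi' Hs' Hl' Hc' Hr'|c' s d0 x' f ? ? He Hs']; subst.
    + destruct (IHi _ _ Hi') as [<- <-].
      destruct (n' x); eapply site_functional; eassumption.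
    + destruct (IHi _ _ Hi') as [<- E]; injection E as <- <-.
      pose proof (site_functional _ _ _ _ Hs Hs') as E; injection E as <-.
      rewrite <- (lexical_functional _ _ _ _ _ Hl Hl') in Hc'.
      rewrite <- (IHc _ Hc') in Hr'; auto.
    + inversion Hi; subst; binder_clash.
  - intros c s d x f t' d' _ IHe Hs _ IHr t2 d2 H'.
    inversion H' as [? ? ? N' Hi'|? ? l' ? x' n' e' ? ? Hi'
      |c' s' d0 x' f' ? ? He' Hs']; subst; auto.
    + inversion Hi'; subst; binder_clash.
    + inversion Hi'; subst; binder_clash.
  - intros t' d' H'; inversion H'; auto.
  - intros c t d a b _ IH Hs t' d' H'; inversion H' as [|? ? ? ? ? Hr| |]; subst.
    destruct (IH _ _ Hr) as [_ <-]; auto.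
  - intros c t d a b _ IH Hs t' d' H'; inversion H' as [| |? ? ? ? ? Hr|]; subst.
    destruct (IH _ _ Hr) as [_ <-]; auto.
  - intros c s d x f _ IH Hs t' d' H'; inversion H' as [| | |? ? ? ? ? Hr]; subst.
    destruct (IH _ _ Hr) as [_ <-]; auto.
  - intros c t d x f _ IH Hs t' d' H'.
    inversion H' as [? ? ? ? ? Hr Hs'|? ? ? ? ? ? ? ? ? Hr Hs']; subst;
      destruct (IH _ _ Hr) as [<- <-]; auto.
    pose proof (site_functional _ _ _ _ Hs Hs'); discriminate.
  - intros c t d a b s' d' s f _ IH Hs _ _ _ IHe t2 d2 H'.
    inversion H' as [? ? ? ? ? Hr Hs'|? ? ? ? ? ? ? ? ? Hr Hs' _ He]; subst;
      destruct (IH _ _ Hr) as [<- <-]; auto.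
    pose proof (site_functional _ _ _ _ Hs Hs'); discriminate.
  - intros c t d H IH t' H'.
    apply (encloses_term_path _ _ _ _ (resolves_term_path _ _ _ _ H)) in H'.
    now apply IH in H'.
  - intros c t d a b _ _ _ t' H'.
    inversion H' as [? ? ? Hr|? ? ? ? ? Hr|]; subst; trivial.
    apply resolves_term_path in Hr; now apply no_term_path_call in Hr.
  - intros c s d _ IH t' H'.
    inversion H' as [? ? ? Hr| |? ? ? He]; subst.
    + apply resolves_term_path in Hr; now apply no_term_path_call in Hr.
    + now apply IH in He.
  - intros t d e' H'; now inversion H'.
  - intros t t' l d n e _ IH _ IHc e' H'.
    inversion H' as [|? ? ? ? ? ? He Hc]; subst.
    rewrite <- (IH _ He) in Hc; auto.
Qed.

Lemma resolves_functional M0 c t d t' d' :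
  resolves M0 c t d -> resolves M0 c t' d' -> t = t' /\ d = d'.
Proof. intros H H'; now apply (proj1 (machine_functional M0) _ _ _ H). Qed.

(** * Reading closures back as terms *)

(** [bound] repeats the lookup premises of [resolves_var], so the environment is recovered by
    climbing. The mutual induction makes the read-back well-founded, and [closed v] keeps the
    substitution plain. *)
Inductive closure (M0 : term) : path -> path -> term -> Prop :=
| closure_intro t d N s :
    site M0 d N -> (forall x, In x (fv N) -> bound M0 t d x (s x)) ->
    closure M0 t d (subst s N)

with bound (M0 : term) : path -> path -> label -> term -> Prop :=
| bound_intro t l d x n e u d' v :
    closed v -> lexical (translate M0) (rev d) x n -> climbs M0 t d n e ->
    resolves M0 (x :: e) u d' -> closure M0 u d' v -> bound M0 t (l :: d) x v.

Definition denotes (M0 : term) (c : path) (v : term) : Prop :=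
  exists t d, resolves M0 c t d /\ closure M0 t d v.

Lemma bound_closed M0 t d x v : bound M0 t d x v -> closed v.
Proof. now destruct 1. Qed.

Lemma bound_up M0 c t l d x v :
  bound M0 t d x v -> encloses M0 c t d ->
  ~ has (translate M0) (rev d) x -> bound M0 c (l :: d) x v.
Proof.
  intros H He Hh; destruct H as [t l' d x n e u d' v Hv Hl Hc Hr Hcl].
  apply bound_intro with (S n) e u d'; trivial.
  - apply lexical_up with (rev d); trivial; apply init_snoc.
  - now apply climbs_succ with t.
Qed.

Lemma instance_denotes M0 c t d v :
  instance M0 c t d -> closure M0 t d v -> denotes M0 c v.
Proof.
  intros Hi Hc; pose proof Hc as Hc'; destruct Hc as [t d N s Hs Hb].
  destruct N as [x|x e|a b].
  (* A variable denotes what its binding denotes, because substituting in [Var x] gives [s x]. *)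
  - simpl in *; specialize (Hb x (or_introl eq_refl)).
    inversion Hb as [? l d' ? n e u d0 ? _ Hl Hcl Hr Hd]; subst.
    exists u, d0; split; trivial; eapply resolves_var; eassumption.
  - exists t, d; split; trivial; eapply resolves_instance; eauto; discriminate.
  - exists t, d; split; trivial; eapply resolves_instance; eauto; discriminate.
Qed.

Lemma closure_cases M0 c t d v :
  resolves M0 c t d -> closure M0 t d v ->
  (exists x e s, site M0 d (Lam x e) /\
    v = Lam x (subst (update s x (Var x)) e) /\
    forall y, In y (fv (Lam x e)) -> bound M0 t d y (s y)) \/
  (exists a b s, site M0 d (App a b) /\ v = App (subst s a) (subst s b) /\
    forall y, In y (fv (App a b)) -> bound M0 t d y (s y)).
Proof.
  intros Hr Hc; apply resolves_site in Hr; destruct Hr as (N' & HN & n).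
  destruct Hc as [t d N s Hs Hb].
  rewrite (site_functional _ _ _ _ HN Hs) in n.
  destruct N as [x|x e|a b]; [now destruct (n x)|left|right].
  - exists x, e, s; split; [|split]; trivial.
    apply subst_lam; intros y Hy; left; eapply bound_closed; eauto.
  - exists a, b, s; auto.
Qed.

Lemma site_fv_unreserved M0 d N x : site M0 d N -> In x (fv N) -> ~ In x reserved.
Proof.
  intros H; apply site_unreserved in H.
  induction N as [y|y e IH|a IHa b IHb]; simpl in *.
  - now intros [<-|[]].
  - intros Hx; apply in_remove in Hx; tauto.
  - intros Hx; apply in_app_or in Hx; tauto.
Qed.

Lemma site_app_no_has M0 d a b x :
  unreserved M0 -> site M0 d (App a b) -> ~ In x reserved ->
  ~ has (translate M0) (rev d) x.
Proof.
  intros Hu Hs Hx Hh; apply has_inv in Hh; trivial.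
  destruct Hh as [(a' & b' & _ & [E|[E|E]])|[(y & f & _ & E)|[(d' & a' & b' & _ & _ & E)|
      (d' & y & f & -> & _)]]]; try (subst; binder_clash).
  now apply no_site_whnf in Hs.
Qed.

Lemma site_lam_no_has M0 d y f x :
  unreserved M0 -> site M0 d (Lam y f) -> ~ In x reserved ->
  ~ has (translate M0) (rev d) x.
Proof.
  intros Hu Hs Hx Hh; apply has_inv in Hh; trivial.
  destruct Hh as [(a' & b' & _ & [E|[E|E]])|[(z & g & _ & E)|[(d' & a' & b' & _ & _ & E)|
      (d' & z & g & -> & _)]]]; try (subst; binder_clash).
  now apply no_site_whnf in Hs.
Qed.

Lemma call_no_has M0 d x :
  unreserved M0 -> ~ In x reserved -> ~ has (translate M0) (rev (l_call :: d)) x.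
Proof.
  intros Hu Hx Hh; apply has_inv in Hh; trivial.
  destruct Hh as [(a' & b' & _ & [E|[E|E]])|[(y & f & _ & E)|[(d' & a' & b' & _ & _ & E)|
      (d' & y & f & E & _)]]]; try (subst; binder_clash); discriminate.
Qed.

Lemma whnf_no_has M0 d y f x :
  unreserved M0 -> site M0 d (Lam y f) -> ~ In x reserved -> x <> y ->
  ~ has (translate M0) (rev (l_whnf :: d)) x.
Proof.
  intros Hu Hs Hx n Hh; apply has_inv in Hh; trivial.
  destruct Hh as [(a' & b' & _ & [E|[E|E]])|[(z & g & _ & E)|[(d' & a' & b' & _ & _ & E)|
      (d' & z & g & E & Hs' & [<-|[E2|E2]])]]]; try (subst; binder_clash).
  injection E as <-; apply n.
  pose proof (site_functional _ _ _ _ Hs Hs') as E; congruence.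
Qed.

(** Neither the application body nor [__call] defines a variable, so the same bindings are found one
    scope further out from the callee and two further out from the argument. *)
Lemma app_denotes M0 c t d a b s :
  unreserved M0 -> resolves M0 c t d -> site M0 d (App a b) ->
  (forall y, In y (fv (App a b)) -> bound M0 t d y (s y)) ->
  denotes M0 (l_callee :: c) (subst s a) /\
  denotes M0 (l_parameter :: l_call :: c) (subst s b) /\ closed (subst s b).
Proof.
  intros Hu Hr Hs Hb; repeat split.
  - eapply instance_denotes; [eapply instance_callee; eassumption|].
    constructor; [eapply site_callee; eassumption|].
    intros x Hx; assert (Hx' : In x (fv (App a b))) by (simpl; apply in_or_app; auto).
    eapply bound_up; [apply Hb; trivial|now apply encloses_term|].
    eapply site_app_no_has, site_fv_unreserved; eassumption.
  - eapply instance_denotes; [eapply instance_argument; eassumption|].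
    constructor; [eapply site_argument; eassumption|].
    intros x Hx; assert (Hx' : In x (fv (App a b))) by (simpl; apply in_or_app; auto).
    pose proof (site_fv_unreserved _ _ _ _ Hs Hx') as Hxr.
    eapply bound_up; [|eapply encloses_call; eassumption|now apply call_no_has].
    eapply bound_up; [apply Hb; trivial|now apply encloses_term|].
    eapply site_app_no_has; eassumption.
  - apply closed_subst; intros y Hy; eapply bound_closed, Hb.
    simpl; apply in_or_app; auto.
Qed.

(** This is the beta step: the [__call] path becomes the scope of the abstraction body. *)
Lemma result_denotes M0 c s u d x e v :
  unreserved M0 -> evaluates M0 (l_callee :: c) s d -> resolves M0 s u d ->
  closure M0 u d (Lam x e) -> closed v ->
  denotes M0 (l_parameter :: l_call :: c) v ->
  denotes M0 (l_result :: l_call :: c) (subst1 x v e).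
Proof.
  intros Hu He Hr Hc Hv (t' & d' & Hp & Hpv).
  destruct (closure_cases _ _ _ _ _ Hr Hc)
    as [(y & f & r & Hs & E & Hb)|(? & ? & ? & _ & E & _)]; [|discriminate].
  injection E as <- ->.
  rewrite subst1_subst; trivial.
  2: { intros y Hy; eapply bound_closed; auto. }
  eapply instance_denotes; [eapply instance_result; eassumption|].
  constructor; [eapply site_result; eassumption|].
  intros y Hy; destruct (string_dec y x) as [->|n].
  (* Index 0: the scope of the body is the call itself, where [x] refers to [__parameter], that is,
     to the argument. *)
  - rewrite update_eq; apply bound_intro with 0 (l_call :: c) t' d'; trivial.
    + eapply lexical_here, has_binder; eassumption.
    + constructor.
    + eapply resolves_binder; eassumption.
  (* Any other variable passes two scopes, the [__whnf] body and the site of the abstraction. *)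
  - rewrite update_neq by trivial.
    apply in_fv_lam with (x := x) in Hy; trivial.
    pose proof (site_fv_unreserved _ _ _ _ Hs Hy) as Hyr.
    eapply bound_up; [|eapply encloses_whnf; eassumption|].
    + eapply bound_up; [apply Hb; trivial|now apply encloses_term|].
      eapply site_lam_no_has; eassumption.
    + eapply whnf_no_has; eassumption.
Qed.

Lemma eval_evaluates M0 N v :
  unreserved M0 -> eval N v -> forall c, denotes M0 c N ->
  exists s d u, evaluates M0 c s d /\ resolves M0 s u d /\ closure M0 u d v.
Proof.
  intros Hu; induction 1 as [x e|a b x e v _ IHa _ IHv]; intros c (t & d & Hr & Hc).
  - destruct (closure_cases _ _ _ _ _ Hr Hc)
      as [(y & f & r & Hs & _ & _)|(? & ? & ? & _ & E & _)]; [|discriminate].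
    exists c, d, t; split; [|split]; trivial; eapply evaluates_lam; eassumption.
  - destruct (closure_cases _ _ _ _ _ Hr Hc)
      as [(? & ? & ? & _ & E & _)|(a' & b' & r & Hs & E & Hb)]; [discriminate|].
    injection E as -> ->.
    destruct (app_denotes _ _ _ _ _ _ _ Hu Hr Hs Hb) as (Ha & Hp & Hpc).
    destruct (IHa _ Ha) as (s & d0 & u & He & Hr0 & Hc0).
    destruct (IHv (l_result :: l_call :: c)) as (s1 & d1 & u1 & He1 & Hr1 & Hc1).
    { eapply result_denotes; eassumption. }
    exists s1, d1, u1; split; [|split]; trivial.
    eapply evaluates_app; eassumption.
Qed.

Lemma evaluates_eval M0 c s d :
  unreserved M0 -> evaluates M0 c s d -> forall N, denotes M0 c N ->
  exists v u, eval N v /\ resolves M0 s u d /\ closure M0 u d v.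
Proof.
  intros Hu; induction 1 as [c t d x f Hr Hs|c t d a b s' d' s f Hr Hs He IHe _ IH];
    intros N (t' & d0 & Hr' & Hc);
    (* Determinism identifies the closure reached by the machine with the one that denotes [N]. *)
    destruct (resolves_functional _ _ _ _ _ _ Hr Hr') as [<- <-];
    destruct (closure_cases _ _ _ _ _ Hr Hc)
      as [(y & g & r & Hs' & -> & Hb)|(a' & b' & r & Hs' & -> & Hb)];
    try (pose proof (site_functional _ _ _ _ Hs Hs'); discriminate).
  - eexists _, t; split; [constructor|auto].
  - destruct (app_denotes _ _ _ _ _ _ _ Hu Hr Hs' Hb) as (Ha & Hp & Hpc).
    destruct (IHe _ Ha) as (v & u & Hv & Hr0 & Hc0).
    destruct (eval_is_lam _ _ Hv) as (x & e & ->).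
    destruct (IH (subst1 x (subst r b') e)) as (v & u' & Hv' & Hr1 & Hc1).
    { eapply result_denotes; eassumption. }
    exists v, u'; split; [|auto]; econstructor; eassumption.
Qed.

Lemma root_denotes M0 : unreserved M0 -> closed M0 -> denotes M0 [] M0.
Proof.
  intros Hu Hc; eapply instance_denotes; [constructor|].
  rewrite <- (subst_closed Var M0 Hc) at 2.
  constructor; [now constructor|].
  intros x Hx; rewrite Hc in Hx; destruct Hx.
Qed.

Lemma eval_iff_evaluates M0 :
  unreserved M0 -> closed M0 ->
  (exists v, eval M0 v) <-> exists s d, evaluates M0 [] s d.
Proof.
  intros Hu Hc; pose proof (root_denotes _ Hu Hc) as Hd; split.
  - intros [v Hv].
    destruct (eval_evaluates _ _ _ Hu Hv _ Hd) as (s & d & _ & H & _); eauto.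
  - intros (s & d & H).
    destruct (evaluates_eval _ _ _ _ Hu H _ Hd) as (v & _ & Hv & _); eauto.
Qed.

(** * The inheritance semantics and the machine *)

Section supers_induction.

Context (doc : node)
  (Ps : path -> path * path -> Prop) (Po Pb : path -> path -> Prop)
  (Pr : path -> path -> nat -> list label -> path -> Prop)
  (Pt : (path -> Prop) -> path -> nat -> path -> Prop)
  (supers_root_case : Ps [] ([], []))
  (supers_snoc_case : forall p l b b' o,
    clos_refl_trans path (fun x y => bases doc x y /\ Pb x y) (p ++ [l]) b ->
    init b = Some b' -> overrides doc b o -> Po b o -> Ps (p ++ [l]) (b', o))
  (overrides_root_case : Po [] [])
  (overrides_snoc_case : forall p l a b o,
    supers doc p (a, b) -> Ps p (a, b) -> dom_inherits doc (b ++ [l]) ->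
    o = p ++ [l] \/ o = b ++ [l] -> Po (p ++ [l]) o)
  (bases_snoc_case : forall p l o n w t,
    overrides doc (p ++ [l]) o -> Po (p ++ [l]) o -> inherits doc o n w ->
    Pr p o n w t -> Pb (p ++ [l]) t)
  (resolve_case : forall s d d' n w c,
    init d = Some d' -> Pt (eq s) d' n c -> Pr s d n w (c ++ w))
  (this_zero_case : forall (X : path -> Prop) d c, X c -> Pt X d 0 c)
  (this_succ_case : forall (X : path -> Prop) d d' n c t e,
    X c -> supers doc c (t, d) -> Ps c (t, d) -> init d = Some d' ->
    Pt (eq t) d' n e -> Pt X d (S n) e).

(** [clos_refl_trans] is nested in the mutual family, so a generated scheme would give no hypothesis
    on the links of a chain of bases; the inner [go] attaches [Pb] to each link. *)
Fixpoint supers_induction p s (H : supers doc p s) {struct H} : Ps p s :=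
  match H in supers _ p s return Ps p s with
  | supers_root _ => supers_root_case
  | supers_snoc _ p l b b' o Hb Hi Ho =>
      supers_snoc_case p l b b' o
        ((fix go x y (h : clos_refl_trans path (bases doc) x y) {struct h} :
            clos_refl_trans path (fun x y => bases doc x y /\ Pb x y) x y :=
            match h in clos_refl_trans _ _ _ y
              return clos_refl_trans path (fun x y => bases doc x y /\ Pb x y) x y with
            | rt_step _ _ _ z hb => rt_step _ _ _ z (conj hb (bases_induction x z hb))
            | rt_refl _ _ _ => rt_refl _ _ _
            | rt_trans _ _ _ y z h1 h2 => rt_trans _ _ _ y z (go x y h1) (go y z h2)
            end) _ _ Hb)
        Hi Ho (overrides_induction _ _ Ho)
  end
with overrides_induction p o (H : overrides doc p o) {struct H} : Po p o :=
  match H in overrides _ p o return Po p o with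
  | overrides_root _ => overrides_root_case
  | overrides_snoc _ p l a b o Hs Hd Ho =>
      overrides_snoc_case p l a b o Hs (supers_induction _ _ Hs) Hd Ho
  end
with bases_induction p t (H : bases doc p t) {struct H} : Pb p t :=
  match H in bases _ p t return Pb p t with
  | bases_snoc _ p l o n w t Ho Hi Hr =>
      bases_snoc_case p l o n w t Ho (overrides_induction _ _ Ho) Hi
        (resolve_induction _ _ _ _ _ Hr)
  end
with resolve_induction s d n w c (H : resolve doc s d n w c) {struct H} : Pr s d n w c :=
  match H in resolve _ s d n w c return Pr s d n w c with
  | resolve_intro _ s d d' n w c Hi Ht =>
      resolve_case s d d' n w c Hi (this_induction _ _ _ _ Ht)
  end
with this_induction X d n e (H : this doc X d n e) {struct H} : Pt X d n e :=
  match H in this _ X d n e return Pt X d n e with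
  | this_zero _ X d c Hc => this_zero_case X d c Hc
  | this_succ _ X d d' n c t e Hc Hs Hi Ht =>
      this_succ_case X d d' n c t e Hc Hs (supers_induction _ _ Hs) Hi
        (this_induction _ _ _ _ Ht)
  end.

End supers_induction.

(* "overrides" contains the instance path itself beside the overridden site;
   this matters only when that path also occurs in the document. *)
Lemma instance_of_site M0 d N :
  site M0 d N -> term_path d -> instance M0 d (tl d) d.
Proof.
  induction 1 as [H|d a b H IH|d a b H IH|d x e H IH]; intros Ht.
  - constructor.
  - apply term_path_callee_inv in Ht; simpl.
    eapply instance_callee; [|exact H].
    eapply resolves_instance; [now apply IH|exact H|discriminate].
  - inversion Ht; subst; simpl.
    eapply instance_argument; [|exact H].
    eapply resolves_instance; [now apply IH|exact H|discriminate].
  (* A [__result] site lies below [__whnf], not [__call], so it is not a term path. *)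
  - inversion Ht as [| |]; subst.
Qed.

Lemma resolves_of_site M0 d N :
  site M0 d N -> (forall x, N <> Var x) -> term_path d -> resolves M0 d (tl d) d.
Proof.
  intros H n Ht; eapply resolves_instance; [|exact H|exact n].
  eapply instance_of_site; eassumption.
Qed.

(** * From the semantics to the machine *)

Section soundness.

Context (M0 : term) (Hu : unreserved M0).

Let doc := translate M0.

(** One clause for each kind of path visited. A pair at [__call] may come from the call or from the
    abstraction of its callee, hence [encloses]; a pair at [__whnf] pins down an abstraction. *)
Definition supers_spec (p : path) (s : path * path) : Prop :=
  (exists l, has doc (snd s) l) ->
  (term_path (rev p) -> resolves M0 (rev p) (rev (fst s)) (rev (snd s))) /\
  (forall c, rev p = l_call :: c -> term_path c ->
    encloses M0 (rev p) (rev (fst s)) (rev (snd s))) /\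
  (forall c, rev p = l_whnf :: c -> term_path c ->
    exists d, rev (snd s) = l_whnf :: d /\ evaluates M0 c (rev (fst s)) d).

(** Besides its instance, a term path may override the binder body of the abstraction being called,
    or, at the argument, the empty [__parameter] of that abstraction, which contributes no
    members. *)
Definition overrides_spec (p o : path) : Prop :=
  dom_inherits doc o ->
  (term_path (rev p) ->
    instance M0 (rev p) (tl (rev p)) (rev o) \/
    (exists c s d x f, rev p = x :: l_call :: c /\ rev o = x :: l_whnf :: d /\
      evaluates M0 (l_callee :: c) s d /\ site M0 d (Lam x f)) \/
    (exists d x f, rev o = l_parameter :: l_whnf :: d /\ site M0 d (Lam x f))) /\
  (forall c, rev p = l_call :: c -> term_path c ->
    exists t d a b, rev o = l_call :: d /\ resolves M0 c t d /\ site M0 d (App a b)) /\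
  (forall c, rev p = l_whnf :: c -> term_path c ->
    exists t d, rev o = l_whnf :: d /\ resolves M0 c t d).

(** The clause for term paths runs backwards: a base is a redirection, so what [q] resolves to is
    what [p] resolves to. *)
Definition bases_spec (p q : path) : Prop :=
  (term_path (rev p) ->
    term_path (rev q) /\
    forall t d, resolves M0 (rev q) t d -> resolves M0 (rev p) t d) /\
  (forall c, rev p = l_call :: c -> term_path c -> rev q = l_whnf :: l_callee :: c) /\
  (forall c, rev p = l_whnf :: c -> term_path c ->
    rev q = l_whnf :: l_result :: l_call :: c /\
    exists t d a b, resolves M0 c t d /\ site M0 d (App a b)).

(** [X] is confined to the single path [s], because [resolve] starts [this] from a singleton and
    each step continues from one. *)
Definition this_spec (X : path -> Prop) (d : path) (n : nat) (e : path) : Prop :=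
  forall s u, (forall c, X c -> c = s) -> encloses M0 (rev s) u (rev d) ->
  climbs M0 (rev s) (rev d) n (rev e).

Definition resolve_spec (s d : path) (n : nat) (w : list label) (c : path) : Prop :=
  exists d' e, init d = Some d' /\ c = e ++ w /\ this_spec (eq s) d' n e.

Lemma this_spec_succ (X : path -> Prop) d d' n c t e :
  X c -> supers_spec c (t, d) -> init d = Some d' -> this_spec (eq t) d' n e ->
  this_spec X d (S n) e.
Proof.
  intros Hc Hs Hi Ht s u HX He.
  apply HX in Hc; subst c.
  apply init_some in Hi; destruct Hi as [l Ed].
  destruct Hs as (Hs1 & Hs2 & _).
  { destruct (encloses_has _ _ _ _ He) as [l' Hl']; rewrite rev_involutive in Hl'; eauto. }
  assert (He' : encloses M0 (rev s) (rev t) (rev d)).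
  { destruct (encloses_scope _ _ _ _ He) as [Hp|(c' & Ec & Hp)].
    - now apply encloses_term, Hs1.
    - now apply (Hs2 c'). }
  rewrite Ed in *.
  apply climbs_succ with (rev t); trivial.
  destruct (encloses_parent _ _ _ _ _ He') as [u' Hu'].
  apply (Ht t u'); auto.
Qed.

Lemma has_app d l :
  has doc (rev d) l -> l = l_callee \/ l = l_call -> exists a b, site M0 d (App a b).
Proof.
  intros H Hl; apply has_inv in H; trivial.
  destruct H as [(a & b & Hs & _)|[(x & e & _ & ->)|[(d' & a & b & _ & _ & ->)|
    (d' & x & e & _ & Hs & [<-|[-> | ->]])]]]; eauto;
  try (destruct Hl; discriminate).
  destruct Hl; binder_clash.
Qed.

Lemma has_term d :
  has doc (rev d) l_whnf -> exists N, site M0 d N /\ forall x, N <> Var x.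
Proof.
  intros H; apply has_inv in H; trivial.
  destruct H as [(a & b & Hs & _)|[(x & e & Hs & _)|[(d' & a & b & _ & _ & E)|
    (d' & x & e & _ & Hs & [E|[E|E]])]]]; try discriminate.
  - eexists; split; [exact Hs|discriminate].
  - eexists; split; [exact Hs|discriminate].
  - binder_clash.
Qed.

Lemma has_call_label d l :
  has doc (rev (l_call :: d)) l ->
  (exists a b, site M0 d (App a b)) /\ l = l_parameter.
Proof.
  intros H; apply has_inv in H; trivial.
  destruct H as [(a & b & Hs & _)|[(x & e & Hs & _)|[(d' & a & b & E & Hs & ->)|
    (d' & x & e & E & _)]]]; try (now apply no_site_call in Hs); try discriminate.
  injection E as <-; eauto.
Qed.

Lemma has_whnf_inv d l :
  has doc (rev (l_whnf :: d)) l ->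
  exists x e, site M0 d (Lam x e) /\ (l = x \/ l = l_parameter \/ l = l_result).
Proof.
  intros H; apply has_inv in H; trivial.
  destruct H as [(a & b & Hs & _)|[(x & e & Hs & _)|[(d' & a & b & E & Hs & ->)|
    (d' & x & e & E & Hs & Hl)]]]; try (now apply no_site_whnf in Hs); try discriminate.
  injection E as <-; eauto.
Qed.

Lemma overrides_spec_snoc p l a b o :
  supers_spec p (a, b) -> dom_inherits doc (b ++ [l]) ->
  o = p ++ [l] \/ o = b ++ [l] -> overrides_spec (p ++ [l]) o.
Proof.
  intros Hs Hb Ho Hd; rewrite rev_unit.
  apply dom_inherits_snoc in Hb.
  destruct Hs as (Hs1 & Hs2 & _); [simpl; eauto|].
  simpl in Hs1, Hs2.
  rewrite <- (rev_involutive b) in Hb.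
  (* The instance path itself matters as an override only if it is also a position of the
     document. *)
  assert (Ho' : rev o = l :: rev b \/ has doc (rev (rev p)) l /\ rev o = l :: rev p).
  { destruct Ho as [-> | ->]; rewrite rev_unit; auto.
    right; rewrite rev_involutive; split; trivial; now apply dom_inherits_snoc. }
  clear Ho Hd; revert Hs1 Hs2 Hb Ho'.
  generalize (rev p) (rev a) (rev b) (rev o); clear p a b o.
  intros p a b o Hs1 Hs2 Hb Ho; repeat split.
  - intros Ht; inversion Ht as [|c Hc|l' c Hl Hc]; subst; simpl.
    + left; destruct Ho as [-> |[Hp ->]].
      * destruct (has_app _ _ Hb) as (x & y & Hs); auto.
        eapply instance_callee; eauto.
      * destruct (has_app _ _ Hp) as (x & y & Hs); auto.
        eapply instance_callee; [|exact Hs].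
        eapply resolves_of_site; [exact Hs|discriminate|trivial].
    + destruct Ho as [-> |[Hp ->]].
      * pose proof (Hs2 _ eq_refl Hc) as He.
        inversion He as [? ? ? Hr|? ? d x y Hr Hs|? ? d Hv]; subst.
        -- apply resolves_term_path in Hr; now apply no_term_path_call in Hr.
        -- apply has_call_label in Hb; destruct Hb as [_ ->].
           left; eapply instance_argument; eassumption.
        (* The binder, the empty [__parameter] and the [__result] of the abstraction, seen at the
           call, give the three outcomes of the invariant. *)
        -- apply has_whnf_inv in Hb; destruct Hb as (x & e & Hs & [-> |[-> | ->]]).
           ++ right; left; eauto 12.
           ++ right; right; eauto.
           ++ left; eapply instance_result; eassumption.
      * apply has_call_label in Hp; destruct Hp as [(x & y & Hs) ->].
        left; eapply instance_argument; [|exact Hs].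
        eapply resolves_of_site; [exact Hs|discriminate|trivial].
  - intros c [= -> ->] Hc; destruct Ho as [-> |[Hp ->]].
    + destruct (has_app _ _ Hb) as (x & y & Hs); eauto 10.
    + destruct (has_app _ _ Hp) as (x & y & Hs); auto.
      do 4 eexists; split; [|split]; [reflexivity| |exact Hs].
      eapply resolves_of_site; [exact Hs|discriminate|trivial].
  - intros c [= -> ->] Hc; destruct Ho as [-> |[Hp ->]]; eauto.
    destruct (has_term _ Hp) as (N & Hs & n).
    do 2 eexists; split; [reflexivity|].
    eapply resolves_of_site; eassumption.
Qed.

Lemma bases_spec_snoc p l o n w t :
  overrides_spec (p ++ [l]) o -> inherits doc o n w -> resolve_spec p o n w t ->
  bases_spec (p ++ [l]) t.
Proof.
  intros Ho Hi (d' & e & Ed & -> & Ht).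
  specialize (Ho (proj1 Hi)); revert Ho; unfold bases_spec; rewrite rev_unit, rev_app_distr.
  apply init_some in Ed; destruct Ed as [l' Ed].
  rewrite <- (rev_involutive o) in Hi.
  specialize (fun u => Ht p u (fun c H => eq_sym H)).
  rewrite Ed in *; clear o Ed; revert Hi Ht.
  generalize (rev p) (rev d') (rev e); clear p d' e; intros p d e Hi Ht (H1 & H2 & H3).
  apply inherits_inv in Hi; trivial.
  split; [|split].
  - intros Hp; destruct (H1 Hp) as
      [H|[(c & s & d0 & x & f & E & E' & Hv & Hs)|(d0 & x & f & E & Hs)]];
      clear H1 H2 H3.
    + simpl in H; destruct (instance_parent _ _ _ _ _ H) as [u Hpu].
      apply Ht in Hpu; clear Ht.
      destruct (instance_site _ _ _ _ Hu H) as [N HN].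
      destruct Hi as [(l0 & d1 & x & [= -> ->] & Hs & Hl & ->)|[(d1 & a & b & [= -> ->] & _)|
        [(d1 & a & b & [= -> ->] & _)|(d1 & x & f & [= -> ->] & Hs & _)]]].
      (* Among instances only a variable site carries a reference; its target is the binder label at
         the call found by climbing. *)
      * pose proof (site_unreserved _ _ _ Hs) as Hx; simpl in Hx.
        destruct (instance_parent _ _ _ _ _ H) as [u' Hpu'].
        destruct (climbs_binder _ _ _ _ _ _ _ Hu Hx Hpu' Hl Hpu)
          as (c & s & d' & f & -> & Hv & Hs').
        split.
        -- simpl; apply term_path_call; auto.
           apply term_path_callee_inv; eapply machine_term_path; eassumption.
        -- intros t d0 Hr; simpl in Hr; eapply resolves_var; eassumption.
      * now apply no_site_call in HN.
      * now apply no_site_whnf in HN.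
      * inversion HN; subst; binder_clash.
    + injection E as -> ->; injection E' as -> ->.
      destruct Hi as [(l0 & d1 & y & E & Hs' & _)|[(d1 & a & b & [= -> _] & _)|
        [(d1 & a & b & [= -> _] & _)|(d1 & y & f' & [= <- <-] & Hs' & -> & ->)]]];
        try binder_clash.
      * inversion Hs'; subst; binder_clash.
      * assert (He : encloses M0 (l_call :: c) s (l_whnf :: d0)) by now apply encloses_whnf.
        apply Ht in He; inversion He; subst.
        assert (Hc : term_path c)
          by (apply term_path_callee_inv; eapply machine_term_path; eassumption).
        split.
        -- simpl; apply term_path_call; auto.
        -- intros t d Hr; simpl in Hr; eapply resolves_binder; eassumption.
    + injection E as -> ->.
      destruct Hi as [(l0 & d1 & y & E & Hs' & _)|[(d1 & a & b & E & _)|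
        [(d1 & a & b & E & _)|(d1 & y & f' & [= <- <-] & Hs' & _)]]];
        try discriminate; try binder_clash.
      inversion Hs'.
  - intros c [= -> ->] Hc; destruct (H2 _ eq_refl Hc) as (t & d0 & a & b & [= -> ->] & Hr & Hs).
    clear H1 H2 H3.
    destruct Hi as [(l0 & d1 & y & E & Hs' & _)|[(d1 & a' & b' & [= <-] & _ & -> & ->)|
      [(d1 & a' & b' & E & _)|(d1 & y & f' & [= <- _] & Hs' & _)]]];
      try discriminate; try binder_clash.
    + now apply no_site_call in Hs'.
    + apply encloses_term, Ht in Hr; inversion Hr; subst; reflexivity.
  - intros c [= -> ->] Hc; destruct (H3 _ eq_refl Hc) as (t & d0 & [= -> ->] & Hr).
    clear H1 H2 H3.
    destruct Hi as [(l0 & d1 & y & E & Hs' & _)|[(d1 & a' & b' & E & _)|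
      [(d1 & a' & b' & [= <-] & Hs & -> & ->)|(d1 & y & f' & [= <- _] & Hs' & _)]]];
      try discriminate; try binder_clash.
    + now apply no_site_whnf in Hs'.
    + split; [|eauto 10].
      apply encloses_term, Ht in Hr; inversion Hr; subst; reflexivity.
Qed.

(** A chain keeps the kind of its path, except that a chain leaving a call enters the [__whnf] chain
    of the callee and stays there. What holds at its end is carried back link by link. *)
Lemma bases_star_spec p q :
  clos_refl_trans path (fun x y => bases doc x y /\ bases_spec x y) p q ->
  (term_path (rev p) ->
    term_path (rev q) /\
    forall t d, resolves M0 (rev q) t d -> resolves M0 (rev p) t d) /\
  (forall c, rev p = l_whnf :: c -> term_path c ->
    exists c', rev q = l_whnf :: c' /\ term_path c' /\
      forall s d, evaluates M0 c' s d -> evaluates M0 c s d) /\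
  (forall c, rev p = l_call :: c -> term_path c ->
    rev q = rev p \/
    exists c', rev q = l_whnf :: c' /\ term_path c' /\
      forall s d, evaluates M0 c' s d -> evaluates M0 (l_callee :: c) s d).
Proof.
  intros H; apply clos_rt_rt1n in H.
  induction H as [p|p p' q [_ (H1 & H2 & H3)] _ (IH1 & IH2 & IH3)].
  - split; [|split]; eauto.
  - split; [|split].
    + intros Hp; destruct (H1 Hp) as [Hp' Hr].
      destruct (IH1 Hp') as [Hq Hr']; auto.
    + intros c E Hc; destruct (H3 _ E Hc) as (E' & t & d & a & b & Hr & Hs).
      destruct (IH2 _ E') as (c' & Eq & Hc' & He).
      { apply term_path_call; auto. }
      exists c'; split; [|split]; trivial; intros s f Hv; apply He in Hv.
      destruct (evaluates_callee _ _ _ _ Hv) as (s' & d' & Hv').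
      eapply evaluates_app; eassumption.
    + intros c E Hc; right; apply (IH2 _ (H2 _ E Hc)).
      now apply term_path_callee.
Qed.

Lemma supers_spec_snoc p l b b' o :
  clos_refl_trans path (fun x y => bases doc x y /\ bases_spec x y) (p ++ [l]) b ->
  init b = Some b' -> overrides_spec b o -> supers_spec (p ++ [l]) (b', o).
Proof.
  intros Hb Hi Ho [k Hk]; simpl in Hk |- *.
  specialize (Ho (has_dom _ _ _ Hk)).
  apply bases_star_spec in Hb; revert Hb Ho.
  rewrite <- (rev_involutive o) in Hk; revert Hk.
  apply init_some in Hi; destruct Hi as [l' ->].
  generalize (rev (p ++ [l])) (rev b') (rev o); clear p l b b' o.
  intros p b o Hk (B1 & B2 & B3) (O1 & O2 & O3).
  (* The [__whnf] body of an application defines no label, so an overridden [__whnf] site that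
     defines one belongs to an abstraction, and evaluation has ended there. *)
  assert (Hlam : forall c, l' :: b = l_whnf :: c -> term_path c ->
    exists d, o = l_whnf :: d /\ evaluates M0 c b d).
  { intros c [= -> ->] Hc; destruct (O3 _ eq_refl Hc) as (t & d & -> & Hr).
    apply has_whnf_inv in Hk; destruct Hk as (x & e & Hs & _).
    exists d; split; trivial; eapply evaluates_lam; eassumption. }
  split; [|split].
  - intros Hp; destruct (B1 Hp) as [Hb Hr]; apply Hr.
    destruct (O1 Hb) as
      [H|[(c & s & d0 & x & f & E & -> & Hv & Hs)|(d0 & x & f & -> & Hs)]].
    + simpl in H; destruct (instance_site _ _ _ _ Hu H) as [N HN].
      eapply resolves_instance; [exact H|exact HN|].
      intros x ->; apply has_inv in Hk; trivial.
      destruct Hk as [(a & b' & Hs & _)|[(x' & e & Hs & _)|[(d' & a & b' & -> & _)|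
        (d' & y & e & -> & _)]]].
      * pose proof (site_functional _ _ _ _ HN Hs); discriminate.
      * pose proof (site_functional _ _ _ _ HN Hs); discriminate.
      * now apply no_site_call in HN.
      * now apply no_site_whnf in HN.
    + apply has_inv in Hk; trivial.
      destruct Hk as [(a & b' & Hs' & _)|[(x' & e & Hs' & _)|[(d' & a & b' & [= -> _] & _)|
        (d' & y & e & [= -> _] & _)]]]; try binder_clash;
        inversion Hs'; subst; binder_clash.
    + apply has_inv in Hk; trivial.
      destruct Hk as [(a & b' & Hs' & _)|[(x' & e & Hs' & _)|[(d' & a & b' & E & _)|
        (d' & y & e & E & _)]]]; try discriminate; inversion Hs'.
  - intros c -> Hc; destruct (B3 _ eq_refl Hc) as [[= -> ->]|(c' & E & Hc' & He)].
    + destruct (O2 _ eq_refl Hc) as (t & d & a & b' & -> & Hr & Hs).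
      eapply encloses_call; eassumption.
    + destruct (Hlam _ E Hc') as (d & -> & Hv); injection E as -> <-.
      apply encloses_whnf; auto.
  - intros c -> Hc; destruct (B2 _ eq_refl Hc) as (c' & E & Hc' & He).
    destruct (Hlam _ E Hc') as (d & -> & Hv); injection E as -> <-; eauto.
Qed.

Lemma supers_sound p s : supers doc p s -> supers_spec p s.
Proof.
  apply (supers_induction doc supers_spec overrides_spec bases_spec resolve_spec this_spec).
  - intros [l Hl]; simpl in *; split; [|split]; try discriminate; intros _.
    eapply resolves_instance; [constructor|now constructor|].
    intros x ->; apply (has_inv _ []) in Hl; trivial.
    destruct Hl as [(a & b' & Hs & _)|[(x' & e & Hs & _)|[(d' & a & b' & [=] & _)|
      (d' & y & e & [=] & _)]]]; inversion Hs.
  - intros; eapply supers_spec_snoc; eassumption.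
  - intros _; split; [|split]; try discriminate; left; constructor.
  - intros; eapply overrides_spec_snoc; eassumption.
  - intros; eapply bases_spec_snoc; eassumption.
  - intros r d d' n w c Hi Ht; exists d', c; auto.
  - intros X d c Hc r u HX _; apply HX in Hc; subst; constructor.
  - intros; eapply this_spec_succ; eassumption.
Qed.

End soundness.

Lemma converges_evaluates M0 :
  unreserved M0 -> converges (translate M0) -> exists s d, evaluates M0 [] s d.
Proof.
  intros Hu [s Hs].
  (* Even a nonempty chain of bases begins with a link that rests on an override of its starting
     path. *)
  assert (Ho : exists o, overrides (translate M0) [l_whnf; l_parameter] o).
  { remember [l_whnf; l_parameter] as q eqn:Eq.
    destruct Hs as [|p l b b' o Hb _ Ho]; [discriminate|].
    apply clos_rt_rt1n in Hb; destruct Hb as [|y b Hb _]; [eauto|].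
    destruct Hb; eauto. }
  destruct Ho as [o Ho]; remember [l_whnf; l_parameter] as q eqn:Eq.
  destruct Ho as [|p l a b o Hp Hd _]; [discriminate|].
  apply (app_inj_tail p [l_whnf]) in Eq; destruct Eq as [-> ->].
  apply dom_inherits_snoc in Hd.
  destruct (supers_sound _ Hu _ _ Hp) as (_ & _ & H); [simpl; eauto|].
  destruct (H [] eq_refl term_path_root) as (d & _ & He); eauto.
Qed.

(** * From the machine to the semantics *)

Lemma supers_own doc p l o :
  overrides doc (rev (l :: p)) o -> supers doc (rev (l :: p)) (rev p, o).
Proof.
  intros Ho; apply supers_snoc with (rev (l :: p)); trivial.
  - apply rt_refl.
  - apply init_snoc.
Qed.

Lemma overrides_own doc p a b l :
  supers doc (rev p) (a, rev b) -> has doc (rev b) l ->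
  overrides doc (rev (l :: p)) (rev (l :: b)).
Proof.
  intros Hs Hb; apply overrides_snoc with a (rev b); trivial.
  - now apply dom_inherits_snoc.
  - now right.
Qed.

(** The chain of bases is prolonged by one link. The root is set apart because its supers come from
    a separate equation. *)
Lemma supers_bases doc c e s :
  c <> [] -> bases doc (rev c) e -> e <> [] -> supers doc e s -> supers doc (rev c) s.
Proof.
  intros Hc Hb He Hs; destruct Hs as [|p l b b' o Hb' Hi Ho]; [now destruct He|].
  destruct c as [|x c]; [now destruct Hc|].
  apply supers_snoc with b; trivial.
  now apply rt_trans with (p ++ [l]); [apply rt_step|].
Qed.

Lemma bases_here doc l p k d w :
  overrides doc (rev (l :: p)) (rev (k :: d)) -> inherits doc (rev (k :: d)) 0 w ->
  bases doc (rev (l :: p)) (rev p ++ w).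
Proof.
  intros Ho Hi; apply bases_snoc with (rev (k :: d)) 0 w; trivial.
  apply resolve_intro with (rev d); [apply init_snoc|now constructor].
Qed.

Lemma inherits_var M0 l d x n :
  site M0 (l :: d) (Var x) -> lexical (translate M0) (rev d) x n ->
  inherits (translate M0) (rev (l :: d)) n [x].
Proof.
  intros H Hl; eapply position_inherits; [exact (position_site _ _ _ H)|member|exact Hl].
Qed.

Lemma inherits_call M0 d a b :
  site M0 d (App a b) ->
  inherits (translate M0) (rev (l_call :: d)) 0 [l_callee; l_whnf].
Proof.
  intros H; eapply position_inherits; [exact (position_call _ _ _ _ H)|member|].
  eapply lexical_here, has_callee; eassumption.
Qed.

Lemma inherits_app_whnf M0 d a b :
  site M0 d (App a b) ->
  inherits (translate M0) (rev (l_whnf :: d)) 0 [l_call; l_result; l_whnf].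
Proof.
  intros H; eapply position_inherits; [exact (position_app_whnf _ _ _ _ H)|member|].
  eapply lexical_here, has_call; eassumption.
Qed.

Lemma inherits_binder M0 d x e :
  site M0 d (Lam x e) ->
  inherits (translate M0) (rev (x :: l_whnf :: d)) 0 [l_parameter].
Proof.
  intros H; eapply position_inherits; [exact (position_binder _ _ _ _ H)|member|].
  eapply lexical_here, has_parameter; eassumption.
Qed.

Lemma rev_app_cons {A} (p : list A) x y z : rev p ++ [x; y; z] = rev (z :: y :: x :: p).
Proof. simpl; now rewrite <- !app_assoc. Qed.

(** The rules that apply an abstraction record only that the callee evaluates, not the application
    site. [call_inherits] therefore carries along the base link from the call to the [__whnf] of its
    callee, established when the callee is instantiated. *)
Lemma supers_complete M0 :
  let doc := translate M0 in
  let call_inherits c := forall c', c = l_callee :: c' ->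
    bases doc (rev (l_call :: c')) (rev (l_whnf :: c)) in
  (forall c t d, resolves M0 c t d ->
    supers doc (rev c) (rev t, rev d) /\ call_inherits c) /\
  (forall c t d, instance M0 c t d ->
    overrides doc (rev c) (rev d) /\ (d = [] \/ exists l, c = l :: t) /\
    supers doc (rev c) (rev t, rev d) /\ call_inherits c) /\
  (forall c s d, evaluates M0 c s d ->
    supers doc (rev (l_whnf :: c)) (rev s, rev (l_whnf :: d)) /\ call_inherits c) /\
  (forall c t d, encloses M0 c t d -> supers doc (rev c) (rev t, rev d)) /\
  (forall t d n e, climbs M0 t d n e -> this doc (eq (rev t)) (rev d) n (rev e)).
Proof.
  intros doc call_inherits.
  assert (Hcall : forall c s d,
    supers doc (rev (l_whnf :: l_callee :: c)) (rev s, rev (l_whnf :: d)) ->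
    call_inherits (l_callee :: c) ->
    supers doc (rev (l_call :: c)) (rev s, rev (l_whnf :: d))).
  { intros c s d Hs Hc; eapply supers_bases; [|now apply Hc| |exact Hs]; try discriminate.
    simpl; now destruct (rev c ++ [l_callee]). }
  apply machine_ind.
  - intros c t d N Hi (_ & _ & Hs & Hc) _ _; auto.
  - intros c t l d x n e t' d' Hi (Ho & Hl & Hs & Hc) Hx Hlx _ Ht _ (Hr & _).
    split; trivial.
    (* Away from the root, the scope of an instance is the parent of its path, from which [resolve]
       starts. *)
    destruct Hl as [|[k ->]]; [discriminate|].
    eapply supers_bases; [discriminate| | |exact Hr].
    + apply bases_snoc with (rev (l :: d)) n [x]; trivial.
      * now apply inherits_var.
      * apply resolve_intro with (rev d); trivial; apply init_snoc.
    + simpl; now destruct (rev e).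
  - intros c s d x f t' d' _ (He & Hc) Hs _ (Hr & _); split.
    + eapply supers_bases; [discriminate| | |exact Hr].
      * eapply (bases_here doc x (l_call :: c));
          [|exact (inherits_binder _ _ _ _ Hs)].
        eapply overrides_own; [apply Hcall; eassumption|].
        eapply has_binder; eassumption.
      * simpl; now destruct (rev c ++ [l_call]).
    + intros c' [= -> _]; binder_clash.
  - split; [constructor|]; split; [now left|]; split; [constructor|].
    intros c' [=].
  - intros c t d a b _ (Hr & _) Hs.
    assert (Ho : overrides doc (rev (l_callee :: c)) (rev (l_callee :: d)))
      by (eapply overrides_own; [exact Hr|eapply has_callee; eassumption]).
    split; [|split; [|split]]; eauto using supers_own.
    intros c' [= <-].
    replace (rev (l_whnf :: l_callee :: c)) with (rev c ++ [l_callee; l_whnf])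
      by (simpl; now rewrite <- app_assoc).
    eapply bases_here; [|eapply inherits_call; eassumption].
    eapply overrides_own; [exact Hr|eapply has_call; eassumption].
  - intros c t d a b _ (Hr & _) Hs.
    assert (Ho : overrides doc (rev (l_parameter :: l_call :: c))
                   (rev (l_parameter :: l_call :: d))).
    { eapply overrides_own; [|eapply has_argument; eassumption].
      eapply supers_own, overrides_own; [exact Hr|eapply has_call; eassumption]. }
    split; [|split; [|split]]; eauto using supers_own; intros c' [=].
  - intros c s d x f _ (He & Hc) Hs.
    assert (Ho : overrides doc (rev (l_result :: l_call :: c))
                   (rev (l_result :: l_whnf :: d)))
      by (eapply overrides_own; [apply Hcall; eassumption|eapply has_result; eassumption]).
    split; [|split; [|split]]; eauto using supers_own; intros c' [=].
  - intros c t d x f _ (Hr & Hc) Hs; split; trivial.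
    eapply supers_own, overrides_own; [exact Hr|].
    eapply has_whnf_label; [exact Hs|discriminate].
  - intros c t d a b s' d' s f _ (Hr & Hc) Hs _ _ _ (He & _); split; trivial.
    eapply supers_bases; [discriminate| | |exact He].
    + rewrite <- rev_app_cons.
      eapply bases_here; [|eapply inherits_app_whnf; eassumption].
      eapply overrides_own; [exact Hr|].
      eapply has_whnf_label; [exact Hs|discriminate].
    + simpl; now destruct ((rev c ++ [l_call]) ++ [l_result]).
  - intros c t d _ (Hr & _); exact Hr.
  - intros c t d a b _ (Hr & _) Hs.
    eapply supers_own, overrides_own; [exact Hr|eapply has_call; eassumption].
  - intros c s d _ (He & Hc); auto.
  - intros t d; now constructor.
  - intros t t' l d n e _ He _ Ht.
    eapply this_succ; [reflexivity|exact He|apply init_snoc|exact Ht].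
Qed.

Lemma evaluates_converges M0 s d :
  evaluates M0 [] s d -> converges (translate M0).
Proof.
  intros He; destruct (evaluates_resolves _ _ _ _ He) as (_ & x & f & Hs).
  apply supers_complete in He; destruct He as [He _].
  (* The [__parameter] that the root [__whnf] inherits from the abstraction at [d], paired with the
     parent of the test path. *)
  exists (rev [l_whnf], rev (l_parameter :: l_whnf :: d)).
  apply (supers_own _ [l_whnf] l_parameter).
  eapply overrides_own; [exact He|eapply has_parameter; eassumption].
Qed.

Theorem theoremC10 (M : term) (hnames : unreserved M) (hclosed : closed M) :
  has_whnf M <-> converges (translate M).
Proof.
  rewrite has_whnf_eval, eval_iff_evaluates by assumption; split.
  - intros (s & d & H); eapply evaluates_converges; exact H.
  - now apply converges_evaluates.
Qed.
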